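(* Let $\alpha>0$ and $b\in\mathbb R$. When the Lévy process $X$ has unbounded variation paths and its Lévy measure satisfies $\Pi(-\infty,0)<\infty$ or $\Pi(0,\infty)<\infty$, the stochastic differential equation $$Y^b_t=X_t-\alpha\int_0^t1_{(b,\infty)}(Y^b_s)\,ds,\qquad t\ge0,$$ has a unique strong solution.
   Context: $X=\{X_t:t\ge0\}$ is a real-valued Lévy process (started from an arbitrary $x\in\mathbb R$) with natural filtration $\mathbb F$, Gaussian coefficient $\sigma\ge0$ and Lévy measure $\Pi$. It has unbounded variation paths iff $\sigma>0$ or $\int_{(-1,1)\setminus\{0\}}|x|\Pi(dx)=\infty$. A unique strong solution means: an $\mathbb F$-adapted process satisfying the equation almost surely, and any two such processes coincide for all $t\ge0$ almost surely. *)

(* Defs.v *)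
(* MathComp-Analysis, over an arbitrary R : realType.  Processes are indexed
   by R; only their values at times t >= 0 matter. *)
From HB Require Import structures.
From mathcomp Require Import all_boot all_order all_algebra.
From mathcomp Require Import all_classical all_reals all_analysis.
From mathcomp Require Import complex.
Set Implicit Arguments.
Unset Strict Implicit.
Unset Printing Implicit Defensive.
Import Order.TTheory GRing.Theory Num.Theory.
Import numFieldNormedType.Exports.
Local Open Scope classical_set_scope.
Local Open Scope complex_scope.
Local Open Scope ring_scope.

Section paths.
Variable R : realType.
Implicit Types f : R -> R.

Definition cadlag f :=
  (forall t : R, 0 <= t -> f s @[s --> t^'+] --> f t) /\
  (forall t : R, 0 < t -> cvg (f s @[s --> t^'-])).

End paths.

Section processes.
Variables (d : measure_display) (T : measurableType d) (R : realType).
Implicit Types (X Y : R -> T -> R) (F : R -> set (set T)).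

(* F_t = sigma(X_s : 0 <= s <= t), not completed. *)
Definition natural_filtration X : R -> set (set T) := fun t =>
  <<s \bigcup_(s in `[0, t]) preimage_set_system setT (X s) measurable >>.

Definition adapted F X :=
  forall t : R, 0 <= t -> forall B : set R, measurable B -> F t (X t @^-1` B).

Variable P : probability T R.

Record levy_process (x : R) X : Prop := {
  levy_measurable : forall t : R, 0 <= t -> measurable_fun setT (X t) ;
  levy_start : {ae P, forall w, X 0 w = x} ;
  levy_cadlag : {ae P, forall w, cadlag (X ^~ w)} ;
  levy_stationary : forall s h : R, 0 <= s -> 0 <= h ->
    forall B : set R, measurable B ->
    P ((X (s + h) \- X s) @^-1` B) = P ((X h \- X 0) @^-1` B) ;
  levy_independent : forall s t : R, 0 <= s -> s <= t ->
    forall (A : set T) (B : set R), natural_filtration X s A -> measurable B ->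
    P (A `&` (X t \- X s) @^-1` B) = (P A * P ((X t \- X s)%R @^-1` B))%E }.

Definition unbounded_variation_paths X :=
  {ae P, forall w, forall t : R, 0 < t -> ~ bounded_variation 0 t (X ^~ w)}.

End processes.

Section levy_khintchine.
Variables (d : measure_display) (T : measurableType d) (R : realType).

Definition cexp (z : R[i]) : R[i] :=
  let: a +i* b := z in (expR a * cos b) +i* (expR a * sin b).

(* E[exp(i theta Z)] *)
Definition char_fun (P : probability T R) (Z : T -> R) (theta : R) : R[i] :=
  (\int[P]_w cos (theta * Z w)) +i* (\int[P]_w sin (theta * Z w)).

(* A measure on R \ {0} is represented as a measure on R not charging {0}. *)
Definition levy_measure (Pi : {measure set R -> \bar R}) :=
  Pi [set 0] = 0%E /\ (\int[Pi]_z (Num.min 1 (z ^+ 2))%:E < +oo)%E.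

(* Psi(theta) = - i gamma theta + sigma^2 theta^2 / 2
     + \int (1 - e^{i theta z} + i theta z 1_{|z| < 1}) Pi(dz),
   split into its real and imaginary parts. *)
Definition levy_exponent (gamma sigma : R) (Pi : {measure set R -> \bar R})
    (theta : R) : R[i] :=
  (sigma ^+ 2 * theta ^+ 2 / 2 + \int[Pi]_z (1 - cos (theta * z))) +i*
  (- (gamma * theta) +
    \int[Pi]_z (theta * z * \1_(`]-1, 1[%classic : set R) z - sin (theta * z))).

(* sigma and Pi are the Gaussian coefficient and the Levy measure of X (and
   gamma its linear coefficient): the Levy-Khintchine formula
   E[exp(i theta (X_t - X_0))] = exp(- t Psi(theta)). *)
Definition levy_triplet (P : probability T R) (X : R -> T -> R)
    (gamma sigma : R) (Pi : {measure set R -> \bar R}) :=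
  [/\ 0 <= sigma, levy_measure Pi &
    forall t theta : R, 0 <= t ->
      char_fun P (X t \- X 0) theta =
      cexp (- (t%:C * levy_exponent gamma sigma Pi theta))].

End levy_khintchine.

Section refraction.
Variables (d : measure_display) (T : measurableType d) (R : realType).
Variables (P : probability T R) (X : R -> T -> R) (alpha b : R).

(* The measurability clause makes the time integral meaningful, since the
   library's integral is total. *)
Definition satisfies_sde (Y : R -> T -> R) :=
  {ae P, forall w, forall t : R, 0 <= t ->
    let g := fun s : R => \1_(`]b, +oo[%classic : set R) (Y s w) : R in
    measurable_fun (`[0, t]%classic : set R) g /\
    Y t w = X t w - alpha * \int[lebesgue_measure]_(s in `[0, t]) g s}.

Definition strong_solution (Y : R -> T -> R) :=
  adapted (natural_filtration X) Y /\ satisfies_sde Y.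

Definition has_unique_strong_solution :=
  (exists Y, strong_solution Y) /\
  (forall Y Y', strong_solution Y -> strong_solution Y' ->
    {ae P, forall w, forall t : R, 0 <= t -> Y t w = Y' t w}).

End refraction.

(* Main.v *)
(* Uniqueness is pathwise: if A and A' are the occupation times above b of two
   solutions, then (A - A')(1{Y > b} - 1{Y' > b}) <= 0, so (A - A')^2 is
   nonincreasing.  The same one-sided monotonicity makes the explicit Euler
   scheme on dyadic grids converge for every cadlag path to some A, and
   Y = X - alpha A solves the equation as soon as {t : Y_t = b} is Lebesgue
   null.  If Y_s = Y_u = b with s < u then |X_u - X_s| <= alpha (u - s), because
   A is 1-Lipschitz.  This event is independent of F_s and has probability at
   most 3/4 once u - s is small, so the level set cannot have a Lebesgue density
   point with positive probability.

   For the 3/4 bound, put c = Im Psi.  If |X_r - X_0| <= alpha r had probability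
   above 3/4, then E cos(theta (X_r - X_0)) = exp(- r Re Psi) cos(r c) would be
   at least 1/8 for all theta in [0, 1/(alpha r)].  This is absurd if sigma > 0,
   where the exponential is small at 1/(alpha r); and if Pi integrates min(1, |z|)
   to +oo, one-sidedness makes |r c(1/(alpha r))| diverge as r -> 0, so that r c
   crosses +pi or -pi.  In the remaining case the paths have bounded variation:
   at mesh h, E f(X_h - X_0) = O(h) for a finite trigonometric sum f comparable
   to |.|, and Fatou's lemma bounds the variation almost surely. *)
Require Import Defs.
From HB Require Import structures.
From mathcomp Require Import all_boot all_order all_algebra.
From mathcomp Require Import all_classical all_reals all_analysis.
From mathcomp Require Import measurable_realfun complex ring lra.
Set Implicit Arguments.
Unset Strict Implicit.
Unset Printing Implicit Defensive.
Import Order.TTheory GRing.Theory Num.Theory.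
Import numFieldNormedType.Exports.
Local Open Scope classical_set_scope.
Local Open Scope ring_scope.

(** The obstacle is that the indicator jumps at [b] while the law of [Y] is unknown, so
    [P(Y_t = b) = 0] cannot be checked one time at a time. Comparing two times avoids the law: of
    [Y] only adaptedness at the earlier time and the Lipschitz bound on the drift are used, and any
    bound below 1 on the conditional probability of a return contradicts density, taken from the
    right because independence concerns later increments. The Euler scheme converges without any
    modulus of continuity: monotonicity leaves only an integrated grid error, and a cadlag path is
    left-continuous off a countable set. One-sidedness matters only for [Im Psi], where small jumps
    of opposite signs could cancel; when [sigma = 0] no lower bound on [Re Psi] is used beyond its
    sign. As the filtration is not completed, the solution is defined on every path, and null sets
    are carried along explicitly. *)

Section trigonometry.
Variable R : realType.
Implicit Types y z : R.

(** Integrates a pointwise inequality. The bounds below are chained this way: [cos <= 1] gives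
    [sin y <= y], which in turn gives [1 - y^2 / 2 <= cos y]. *)
Lemma derive_ge0_le0 (f df : R -> R) y : 0 <= y ->
  (forall x : R, is_derive x 1 f (df x)) ->
  (forall x : R, 0 <= x -> 0 <= df x) -> f 0 <= f y.
Proof.
move=> y0 fd df0; apply: (@ger0_derive1_ndecry _ f 0) => //.
- move=> x; rewrite in_itv/= andbT => x0; rewrite derive1E.
  by have [_ ->] := fd x; apply: df0; apply: ltW.
- apply: continuous_subspaceT => x.
  by apply: differentiable_continuous; apply/derivable1_diffP; case: (fd x).
Qed.

Lemma ler_sin_ge0 y : 0 <= y -> sin y <= y.
Proof.
move=> y0; rewrite -subr_ge0.
have d (x : R) : is_derive x 1 (fun x : R => x - sin x) (1 - cos x).
  exact: is_deriveB.
have := derive_ge0_le0 y0 d; rewrite sin0 subr0; apply => x _.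
by rewrite subr_ge0 cos_le1.
Qed.

Lemma cos_ge_subr_ge0 y : 0 <= y -> 1 - y <= cos y.
Proof.
move=> y0; rewrite -subr_ge0.
have d (x : R) : is_derive x 1 (fun x : R => cos x - (1 - x)) (- sin x + 1).
  by apply: is_derive_eq; rewrite /GRing.scale/=; lra.
have := derive_ge0_le0 y0 d; rewrite cos0 !subr0 subrr; apply => x _.
by have := sin_le1 x; lra.
Qed.

Lemma cos_ge_sqr y : 1 - y ^+ 2 / 2 <= cos y.
Proof.
rewrite -cos_norm -real_normK ?num_real//.
move: `|y| (normr_ge0 y) => {}y y0; rewrite -subr_ge0.
have d (x : R) : is_derive x 1 (fun x : R => cos x - (1 - x ^+ 2 / 2)) (x - sin x).
  by apply: is_derive_eq; rewrite /GRing.scale/=; lra.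
have := derive_ge0_le0 y0 d.
rewrite cos0 expr0n/= mul0r subr0 subrr; apply => x x0.
by have := ler_sin_ge0 x0; lra.
Qed.

Lemma sin_ge_sqr_ge0 y : 0 <= y -> y - sin y <= y ^+ 2.
Proof.
move=> y0; rewrite -subr_ge0.
have d (x : R) : is_derive x 1 (fun x : R => x ^+ 2 - (x - sin x)) (2 * x - (1 - cos x)).
  by apply: is_derive_eq; rewrite /GRing.scale/=; lra.
have := derive_ge0_le0 y0 d; rewrite sin0 expr0n/= !subr0; apply => x x0.
by have := cos_ge_subr_ge0 x0; lra.
Qed.

Lemma ler_norm_sin y : `|sin y| <= `|y|.
Proof.
wlog y0 : y / 0 <= y.
  move=> H; have [/H//|y0] := leP 0 y.
  by rewrite -normrN -sinN -(normrN y); apply: H; lra.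
rewrite (ger0_norm y0) ler_norml ler_sin_ge0// andbT.
have [y1|y1] := leP 1 y; first by have := sin_geN1 y; lra.
apply: (@le_trans _ _ 0); first lra.
by apply: sin_ge0_pi; have := pi_ge2 R; lra.
Qed.

Lemma ler_norm_sub_sin y : `|y - sin y| <= y ^+ 2.
Proof.
wlog y0 : y / 0 <= y.
  move=> H; have [/H//|y0] := leP 0 y.
  rewrite -normrN -(sqrrN y) opprD -sinN; apply: H; lra.
rewrite ger0_norm ?sin_ge_sqr_ge0// subr_ge0; exact: ler_sin_ge0.
Qed.

End trigonometry.

(** * Dyadic grids and bounded variation *)

Section dyadic_grid.
Variable R : realType.
Implicit Types (s t : R) (f : R -> R).

Definition dyad n (k : nat) : R := k%:R / 2 ^+ n.
Definition cell n s := Num.truncn (s * 2 ^+ n).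

Lemma pow2_gt0 n : 0 < 2 ^+ n :> R. Proof. by rewrite exprn_gt0. Qed.

Lemma dyad_ge0 n k : 0 <= dyad n k.
Proof. by rewrite divr_ge0// ltW// pow2_gt0. Qed.

Lemma dyad_le n k l : (dyad n k <= dyad n l) = (k <= l)%N.
Proof. by rewrite ler_pdivlMr ?pow2_gt0// divfK ?gt_eqF ?pow2_gt0// ler_nat. Qed.

Lemma dyadS n k : dyad n k.+1 = dyad n k + 2 ^- n.
Proof. by rewrite /dyad -natr1 mulrDl mul1r. Qed.

Lemma cell_itv n s : 0 <= s -> dyad n (cell n s) <= s < dyad n (cell n s).+1.
Proof.
move=> s0; rewrite ler_pdivrMr ?ltr_pdivlMr ?pow2_gt0//.
by rewrite truncn_itv// mulr_ge0// ltW// pow2_gt0.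
Qed.

Lemma cell_def n k s : dyad n k <= s < dyad n k.+1 -> cell n s = k.
Proof.
by rewrite ler_pdivrMr ?ltr_pdivlMr ?pow2_gt0// => ?; exact: truncn_def.
Qed.

Lemma le_cell n s t : s <= t -> (cell n s <= cell n t)%N.
Proof. by move=> st; rewrite le_truncn// ler_pM2r// pow2_gt0. Qed.

Lemma pow2_inv_cvg0 : (fun n => 2 ^- n : R) @ \oo --> 0.
Proof.
under eq_fun do rewrite -exprVn.
by apply: cvg_expr; rewrite ger0_norm ?invr_ge0// invf_lt1// ltr1n.
Qed.

Lemma cvg_dyad_cell_succ s : 0 <= s -> (fun n => dyad n (cell n s).+1) @ \oo --> s.
Proof.
move=> s0; apply: (@squeeze_cvgr _ _ _ _ (cst s) (fun n => s + 2 ^- n)).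
- apply: nearW => n /=; have /andP[a b] := cell_itv n s0.
  by rewrite (ltW b) dyadS lerD2r.
- exact: cvg_cst.
- by rewrite -[X in _ --> X](addr0 s); apply: cvgD; [exact: cvg_cst|exact: pow2_inv_cvg0].
Qed.

Lemma cvg_dyad_cell s : 0 <= s -> (fun n => dyad n (cell n s)) @ \oo --> s.
Proof.
move=> s0; apply: (@squeeze_cvgr _ _ _ _ (fun n => s - 2 ^- n) (cst s)).
- apply: nearW => n /=; have /andP[a b] := cell_itv n s0.
  by rewrite a andbT lerBlDr -dyadS ltW.
- by rewrite -[X in _ --> X](subr0 s); apply: cvgB; [exact: cvg_cst|exact: pow2_inv_cvg0].
- exact: cvg_cst.
Qed.

Lemma cvg_right_grid f s : 0 <= s -> f t @[t --> s^'+] --> f s ->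
  (fun n => f (dyad n (cell n s).+1)) @ \oo --> f s.
Proof.
move=> s0 /cvg_at_rightP; apply; split; last exact: cvg_dyad_cell_succ.
by move=> n; have /andP[] := cell_itv n s0.
Qed.

End dyadic_grid.

Section bounded_variation_criterion.
Variable R : realType.

Lemma ler_dist_sum_incr (g : nat -> R) a b : (a <= b)%N ->
  `|g b - g a| <= \sum_(a <= j < b) `|g j.+1 - g j|.
Proof. by move=> ab; rewrite -telescope_sumr//; exact: ler_norm_sum. Qed.

Lemma ler_sum_subgrid (g : nat -> R) (k : nat -> nat) m N :
  {homo k : i j / (i <= j)%N} -> (k m <= N)%N ->
  \sum_(0 <= i < m) `|g (k i.+1) - g (k i)| <= \sum_(0 <= j < N) `|g j.+1 - g j|.
Proof.
move=> kh kN.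
apply: (@le_trans _ _ (\sum_(0 <= j < k m) `|g j.+1 - g j|)); last first.
  by rewrite [leRHS](big_cat_nat _ kN)//= lerDl sumr_ge0.
elim: m {kN} => [|m ih]; first by rewrite big_geq// sumr_ge0.
rewrite big_nat_recr//= [leRHS](@big_cat_nat _ _ _ (k m))//= ?kh//.
by rewrite lerD// ler_dist_sum_incr// kh.
Qed.

Definition dyadic_variation (f : R -> R) n :=
  \sum_(0 <= j < 2 ^ n) `|f (dyad R n j.+1) - f (dyad R n j)|.

(** Right-continuity lets each partition point be replaced by a dyadic point just to its right, at
    vanishing cost, and the resulting sum is dominated by the dyadic variation. The interval stops
    at 1/2 so that these right neighbours stay in [0, 1]. Infinitely many levels suffice, which is
    all that Fatou's lemma provides. *)
Lemma bounded_variation_dyadic (f : R -> R) (B : R) :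
  (forall s : R, 0 <= s -> f t @[t --> s^'+] --> f s) ->
  (forall N, exists2 n, (N <= n)%N & dyadic_variation f n <= B) ->
  bounded_variation 0 (1 / 2) f.
Proof.
move=> fr fB; exists B => _ [l pl <-]; rewrite /variation.
set F := nth _ _.
(* Beyond the last index [nth] returns its default 1/2, so the bounds and the monotonicity hold for
   all indices. *)
have F0 i : 0 <= F i.
  have [il|li] := ltnP i (size l).+1; first exact: itv_partition_nth_ge pl.
  by rewrite /F nth_default//= divr_ge0.
have F2 i : F i <= 1 / 2.
  have [il|li] := ltnP i (size l).+1; first exact: itv_partition_nth_le pl.
  by rewrite /F nth_default.
have Fh : {homo F : i j / (i <= j)%N >-> i <= j}.
  move=> i j; have [jl|lj _] := ltnP j (size l).+1; last first.
    by rewrite {2}/F nth_default.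
  case: pl => pl _; rewrite leq_eqVlt => /predU1P[->//|ij].
  apply/ltW; rewrite /F.
  by apply: (sorted_ltn_nth lt_trans) => //; rewrite inE/= (ltn_trans ij).
pose G n := \sum_(0 <= i < size l)
  `|f (dyad R n (cell n (F i.+1)).+1) - f (dyad R n (cell n (F i)).+1)|.
have cG : G @ \oo --> \sum_(0 <= i < size l) `|(f \o F) i.+1 - (f \o F) i|.
  rewrite /G; elim: (size l) => [|m ih].
    rewrite big_geq//; under eq_fun do rewrite big_geq//.
    exact: cvg_cst.
  rewrite big_nat_recr//=; under eq_fun do rewrite big_nat_recr//=.
  apply: cvgD => //; apply: cvg_norm.
  by apply: cvgB; apply: cvg_right_grid => //; exact: fr.
rewrite leNgt; apply/negP => Bl.
have [N _ HN] : \forall n \near \oo, B < G n by exact: (cvgr_gt _ cG).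
have [n Nn fn] := fB N.+1.
have := HN n (ltnW Nn); rewrite /= ltNge => /negP; apply.
apply: le_trans fn; rewrite /G /dyadic_variation.
apply: (@ler_sum_subgrid (fun j => f (dyad R n j)) (fun i => (cell n (F i)).+1)).
  by move=> i j ij; rewrite ltnS le_cell// Fh.
(* The level exceeds [N], hence is positive, so the last index is at most half of the grid size plus
   one and stays on the grid. *)
case: n Nn {HN} => // n _; rewrite -(ltr_nat R).
apply: (@le_lt_trans _ _ (2 ^ n)%:R); last by rewrite ltr_nat ltn_exp2l.
have := F2 (size l); have := @truncn_itv R (F (size l) * 2 ^+ n.+1).
rewrite mulr_ge0 ?F0 ?(ltW (pow2_gt0 _ _))// => /(_ isT)/andP[+ _] F12.
move=> /le_trans; apply; rewrite natrX exprS; have := pow2_gt0 R n; nra.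
Qed.

End bounded_variation_criterion.

Section oscillation_sum.
Variable R : realType.
Implicit Types y : R.

(* A finite trigonometric sum comparable to |y| on [-1, 1], up to 2^-n. *)
Definition osc n y := \sum_(0 <= k < n) 2 ^- k * (1 - cos (2 ^+ k * y)).

Lemma oscS n y : osc n.+1 y = (1 - cos y) + osc n (2 * y) / 2.
Proof.
rewrite /osc big_nat_recl// expr0 invr1 !mul1r; congr (_ + _).
rewrite mulr_suml; apply: eq_bigr => k _.
by rewrite exprSr invfM mulrAC mulrA.
Qed.

(** Self-similarity under doubling: for [|y| <= 1/2] the recursion carries the bound from [2 y] to
    [y] and halves the error; for larger [|y|] the first term alone is at least [1 - cos (1/2)]. *)
Lemma osc_ge n y : `|y| <= 1 -> (1 - cos (1 / 2)) * `|y| - 2 ^- n <= osc n y.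
Proof.
have c0 : 0 <= 1 - cos (1 / 2) :> R by rewrite subr_ge0 cos_le1.
elim: n y => [|n ih] y y1.
  rewrite /osc big_geq// expr0 invr1 subr_le0.
  by have := cos_ge_subr_ge0 (y := 1 / 2 : R); have := normr_ge0 y; nra.
rewrite oscS exprS invfM; have [yle|ylt] := leP `|y| (1 / 2).
  have := ih (2 * y); rewrite normrM ger0_norm// => h.
  by have := cos_le1 y; have := h ltac:(lra); lra.
have cy : 1 - cos (1 / 2) <= 1 - cos y.
  rewrite lerD2l lerN2 -(cos_norm y) ltW// ltr_cos//.
  - by rewrite in_itv/=; have := pi_ge2 R; lra.
  - by rewrite in_itv/=; have := pi_ge2 R; lra.
have o0 : 0 <= osc n (2 * y).
  by apply: sumr_ge0 => k _; rewrite mulr_ge0 ?invr_ge0 ?exprn_ge0// subr_ge0 cos_le1.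
have : 0 < (2 ^+ n)^-1 :> R by rewrite invr_gt0 exprn_gt0.
by nra.
Qed.

(** The induction needs slack at each doubling, and [min(1, |y|)] leaves none for small [|y|],
    whereas [z / (1 + z)] leaves [z^2 / ((1 + z)(1 + 2 z))]. The constant 12 is the cost of
    [1 - cos y <= 2] when [z > 1], where [2 (1 + z)(1 + 2 z) <= 12 z^2]. *)
Lemma osc_le n y : osc n y <= 12 * (`|y| / (1 + `|y|)).
Proof.
elim: n y => [|n ih] y.
  by rewrite /osc big_geq// mulr_ge0// divr_ge0// addr_ge0.
rewrite oscS; have := ih (2 * y); rewrite normrM (ger0_norm (_ : 0 <= 2))//.
have := cos_ge_sqr y; have := cos_geN1 y; rewrite -(@real_normK _ y) ?num_real//.
move: (osc n _) (cos y) (`|y|) (normr_ge0 y) => a b z z0 h1 h2 h3.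
apply: (@le_trans _ _ (1 - b + 12 * (z / (1 + 2 * z)))).
  have := h3; rewrite -mulrA; set w := z / _; lra.
rewrite -lerBrDr -mulrBr.
have -> : z / (1 + z) - z / (1 + 2 * z) = z ^+ 2 / ((1 + z) * (1 + 2 * z)).
  by field; apply/andP; split; apply: lt0r_neq0; lra.
rewrite mulrA ler_pdivlMr; last by rewrite mulr_gt0; lra.
have [z1|z1] := leP z 1.
  apply: (@le_trans _ _ (z ^+ 2 / 2 * ((1 + z) * (1 + 2 * z)))).
    by apply: ler_wpM2r; nra.
  have : (1 + z) * (1 + 2 * z) <= 6 by nra.
  by have := sqr_ge0 z; nra.
apply: (@le_trans _ _ (2 * ((1 + z) * (1 + 2 * z)))); first by apply: ler_wpM2r; nra.
by nra.
Qed.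

End oscillation_sum.

(** * Cadlag paths *)

Section cadlag_paths.
Variable R : realType.
Implicit Types f : R -> R.

Lemma cvg_right_dist f (x l e : R) : 0 < e -> f t @[t --> x^'+] --> l ->
  exists2 r : R, 0 < r & forall s : R, x < s -> s < x + r -> `|l - f s| < e.
Proof.
move=> e0 /cvgrPdist_lt/(_ _ e0)[r /= r0 H]; exists r => // s xs sr.
by apply: H => //=; rewrite ltr0_norm ?subr_lt0// opprB; lra.
Qed.

Lemma cvg_left_dist f (x l e : R) : 0 < e -> f t @[t --> x^'-] --> l ->
  exists2 r : R, 0 < r & forall s : R, s < x -> x - r < s -> `|l - f s| < e.
Proof.
move=> e0 /cvgrPdist_lt/(_ _ e0)[r /= r0 H]; exists r => // s xs sr.
by apply: H => //=; rewrite gtr0_norm ?subr_gt0//; lra.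
Qed.

Lemma cadlag_locally_bounded f (x : R) : cadlag f -> 0 <= x ->
  exists m : R, exists2 r : R, 0 < r &
    forall s : R, 0 <= s -> `|x - s| < r -> `|f s| <= m.
Proof.
move=> [fr fl] x0.
have [r1 r10 H1] := cvg_right_dist ltr01 (fr _ x0).
have [m [r2 r20 H2]] : exists m : R, exists2 r : R, 0 < r &
    forall s : R, 0 <= s -> s < x -> x - r < s -> `|f s| <= m.
  have [->|xn0] := eqVneq x 0; first by exists 0, 1 => // s s0 sx; lra.
  have xgt0 : 0 < x by rewrite lt_neqAle eq_sym xn0.
  have [r r0 H] := cvg_left_dist ltr01 (fl _ xgt0).
  exists (1 + `|lim (f s @[s --> x^'-])|), r => // s s0 sx xs.
  have := H s sx xs; set l := lim _ => h.
  have := ler_normB l (l - f s); rewrite opprB addrC subrK; lra.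
exists (Num.max m (1 + `|f x|)), (Num.min r1 r2).
  by rewrite lt_min r10.
move=> s s0; rewrite lt_min ltr_norml => /andP[/andP[a b]].
rewrite ltr_norml => /andP[c d]; rewrite le_max.
have [sx|xs|->] := ltgtP s x; first by rewrite H2//; lra.
  have h : `|f x - f s| < 1 by apply: H1 => //; lra.
  have := ler_normB (f x) (f x - f s); rewrite opprB addrC subrK => h2.
  by apply/orP; right; lra.
by apply/orP; right; rewrite lerDr.
Qed.

Lemma cadlag_bounded f (K : R) : cadlag f ->
  exists M : R, forall s : R, 0 <= s <= K -> `|f s| <= M.
Proof.
move=> cf.
have /compact_near_coveringP/(_ R (pinfty_nbhs R) (fun M s => 0 <= s -> `|f s| <= M) _) :=
  @segment_compact R 0 K.
case=> [x /=|M [Mr HM]].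
- rewrite in_itv/= => /andP[x0 xK].
  have [m [r r0 H]] := cadlag_locally_bounded cf x0.
  exists (ball x r, [set M | m < M]) => /=.
    by split; [exact: nbhsx_ballx|exists m; split=> //; exact: num_real].
  by move=> [s M]/= [xs mM] s0; rewrite (le_trans _ (ltW mM))// H.
- exists (M + 1) => s s0K; apply: HM => //=; [by rewrite ltrDl|by case/andP: s0K].
Qed.

(* Choosing for each jump time t a rational q < t such that f stays close to
   f(t-) on ]q, t[ is injective on the jumps of size bounded below. *)
Lemma cadlag_discontinuities_countable f : cadlag f ->
  countable [set t : R | 0 < t /\ ~ (f s @[s --> t^'-] --> f t)].
Proof.
move=> [fr fl].
pose D (e : R) := [set t : R | 0 < t /\ e < `|lim (f s @[s --> t^'-]) - f t|].
apply: (@sub_countable _ _ _ (\bigcup_n D n.+1%:R^-1)).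
  apply: subset_card_le => t /= [t0 ncf].
  have : 0 < `|lim (f s @[s --> t^'-]) - f t|.
    rewrite normr_gt0 subr_eq0; apply/eqP => h; apply: ncf; rewrite -h; exact: fl.
  by move=> /ltr_add_invr[n]; rewrite add0r => hn; exists n.
apply: bigcup_countable => // n _.
set e : R := n.+1%:R^-1; have e0 : 0 < e by rewrite invr_gt0.
have e3 : 0 < e / 3 by rewrite divr_gt0.
have ex (t : R) : exists q : rat, D e t -> ratr q < t /\ forall s : R, s < t -> ratr q < s ->
    `|lim (f s @[s --> t^'-]) - f s| < e / 3.
  have [[t0 Dt]|nD] := pselect (D e t); last by exists 0.
  have [r r0 H] := cvg_left_dist e3 (fl _ t0).
  have [|q] := @rat_in_itvoo R (t - r) t; first lra.
  rewrite in_itv/= => /andP[tq qt]; exists q => _; split=> // s st qs.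
  by apply: H => //; lra.
have [q Hq] := choice ex.
apply/countable_injP; exists (pickle \o q) => t t' /set_mem Dt /set_mem Dt' /=.
move=> /(pcan_inj pickleK).
wlog tt' : t t' Dt Dt' / t < t'.
  move=> H qq; have [/H|/H|//] := ltgtP t t'; first exact.
  by move=> /(_ Dt' Dt (esym qq)).
move=> qq; have [qt h] := Hq _ Dt; have [qt' h'] := Hq _ Dt'.
have := Dt.2; rewrite ltNge => /negP; case.
set s := (t + ratr (q t)) / 2.
have st : s < t by rewrite /s; lra.
have qs : ratr (q t) < s by rewrite /s; lra.
have := h s st qs; have := h' s; have := h' t.
rewrite -qq => /(_ tt' qt) + /(_ (lt_trans st tt') qs).
set l := lim _; set l' := lim _; move: (f s) (f t) => a c.
by rewrite !ltr_norml ler_norml => /andP[? ?] /andP[? ?] /andP[? ?]; apply/andP; lra.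
Qed.

End cadlag_paths.

(** * Primitives and their squared difference *)

Section integral_flow.
Variable R : realType.
Local Notation mu := (@lebesgue_measure R).
Implicit Types (p q e g : R -> R) (s t u : R).

(** Over [N + 1] equal steps the increments add up to at most [C t^2 / (N + 1)], which is
    arbitrarily small. *)
Lemma sublevel_quadratic (G : R -> R) (C t : R) : 0 <= t ->
  (forall s u : R, 0 <= s -> s <= u -> u <= t -> G u - G s <= C * (u - s) ^+ 2) ->
  G t <= G 0.
Proof.
move=> t0 HG.
have GN (N : nat) : G t - G 0 <= C * t ^+ 2 / N.+1%:R.
  pose x k : R := k%:R * (t / N.+1%:R).
  have tN : t = x N.+1 by rewrite /x mulrC divfK ?pnatr_eq0.
  have x0 : 0 = x 0%N by rewrite /x mul0r.
  have dx k : x k.+1 - x k = t / N.+1%:R by rewrite /x -natr1 mulrDl mul1r addrC addKr.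
  have d0 : 0 <= t / N.+1%:R by rewrite divr_ge0.
  rewrite {1}tN [in G 0]x0 -(telescope_sumr (G \o x))//=.
  apply: (@le_trans _ _ (\sum_(0 <= k < N.+1) C * (t / N.+1%:R) ^+ 2)).
    rewrite !big_nat; apply: ler_sum => k kN; rewrite -(dx k); apply: HG.
    - by rewrite /x mulr_ge0.
    - by rewrite -subr_ge0 dx.
    - by rewrite [leRHS]tN /x ler_wpM2r// ler_nat.
  rewrite sumr_const_nat subn0 -mulr_natr le_eqVlt; apply/orP; left; apply/eqP.
  by field; rewrite nat1r pnatr_eq0.
rewrite -subr_le0 leNgt; apply/negP => Gt.
pose c := `|C * t ^+ 2| + 1.
have c0 : 0 < c by rewrite ltr_wpDl.
have [M hM] := ltr_add_invr (divr_gt0 Gt c0); rewrite add0r in hM.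
have := GN M; rewrite leNgt => /negP; apply.
move: hM; rewrite ltr_pdivlMr// => /(le_lt_trans _); apply.
by rewrite mulrC ler_wpM2l ?invr_ge0// (le_trans (ler_norm _))// lerDl.
Qed.

Lemma bounded_integrable_itv (i : interval R) (t C : R) g :
  [set` i] `<=` `[0, t] -> measurable_fun `[0, t] g ->
  (forall s : R, 0 <= s <= t -> `|g s| <= C) ->
  mu.-integrable [set` i] (EFin \o g).
Proof.
move=> it mg gC; apply: (@integrableS _ _ _ mu `[0, t]) => //.
apply: measurable_bounded_integrable => //.
  have := lebesgue_measure_itv `[0, t]; rewrite /= => ->; by case: ifP => // _;
    rewrite -EFinB ltry.
exists C; split; first exact: num_real.
move=> x Cx s; rewrite /= in_itv/= => st.
by rewrite (le_trans (gC _ st))// ltW.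
Qed.

Definition primitive g t := \int[mu]_(s in `[0, t]) g s.

Section primitive.
Variables (t C : R) (g : R -> R).
Hypothesis mg : measurable_fun `[0, t] g.
Hypothesis gC : forall s : R, 0 <= s <= t -> `|g s| <= C.

Lemma primitive_sub s u : 0 <= s -> s <= u -> u <= t ->
  primitive g u - primitive g s = \int[mu]_(r in `]s, u]) g r.
Proof.
move=> s0 su ut; rewrite /primitive Rintegral_itvB//.
apply: (bounded_integrable_itv _ mg gC); apply: subset_itvl; by rewrite bnd_simp.
Qed.

Lemma integrable_itv_oc s u : 0 <= s -> u <= t ->
  mu.-integrable `]s, u] (EFin \o g).
Proof.
move=> s0 ut; apply: (bounded_integrable_itv _ mg gC).
by move=> r /=; rewrite !in_itv/= => /andP[sr ru]; apply/andP; split; lra.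
Qed.

Lemma Rintegral_oc_le (c s u : R) : 0 <= s -> s <= u -> u <= t ->
  (forall r : R, s <= r <= u -> g r <= c) ->
  \int[mu]_(r in `]s, u]) g r <= c * (u - s).
Proof.
move=> s0 su ut gc.
have -> : c * (u - s) = \int[mu]_(r in `]s, u]) c.
  rewrite Rintegral_cst//; congr (_ * _).
  have := lebesgue_measure_itv `]s, u]; rewrite /= lte_fin => ->.
  by case: ltgtP su => // -> _; rewrite subrr.
apply: le_Rintegral => //; first exact: integrable_itv_oc.
  apply: (@bounded_integrable_itv _ t `|c|) => //.
  by move=> r /=; rewrite !in_itv/= => /andP[sr ru]; apply/andP; split; lra.
by move=> r; rewrite /= in_itv/= => /andP[sr ru]; apply: gc; rewrite ru ltW.
Qed.

End primitive.

Lemma primitive_lip (t C : R) g : measurable_fun `[0, t] g ->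
  (forall s : R, 0 <= s <= t -> `|g s| <= C) ->
  forall s u : R, 0 <= s -> s <= u -> u <= t ->
  `|primitive g u - primitive g s| <= C * (u - s).
Proof.
move=> mg gC s u s0 su ut; rewrite (primitive_sub mg gC)//.
rewrite ler_norml; apply/andP; split; last first.
  apply: (Rintegral_oc_le mg gC) => // r /andP[sr ru].
  by rewrite (le_trans (ler_norm _))// gC//; lra.
rewrite lerNl -[leLHS]mulN1r -RintegralZl//; last exact: (integrable_itv_oc mg gC).
under eq_Rintegral do rewrite mulN1r.
apply: (@Rintegral_oc_le t C (\- g)) => //.
- by rewrite -[X in measurable_fun _ X]/(GRing.opp \o g); exact: measurableT_comp.
- by move=> r rt; rewrite (normrN (g r)) gC.
- by move=> r /andP[sr ru]; rewrite (le_trans (ler_norm _))// (normrN (g r)) gC//; lra.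
Qed.

Lemma primitive0 g : primitive g 0 = 0.
Proof. by rewrite /primitive set_itv1 Rintegral_set1. Qed.

(* With D the difference of the primitives, (D^2)' = 2 D D' <= 2 e; the chain
   rule is replaced by quadratic control of the increments of D^2 - 2 int e. *)
Lemma sqr_primitive_sub_le t (C : R) p q e : 0 <= t ->
  measurable_fun `[0, t] p -> measurable_fun `[0, t] q ->
  measurable_fun `[0, t] e ->
  (forall s : R, 0 <= s <= t -> 0 <= p s <= 1) ->
  (forall s : R, 0 <= s <= t -> 0 <= q s <= 1) ->
  (forall s : R, 0 <= s <= t -> `|e s| <= C) ->
  (forall s : R, 0 <= s <= t ->
     (primitive p s - primitive q s) * (p s - q s) <= e s) ->
  (primitive p t - primitive q t) ^+ 2 <= 2 * primitive e t.
Proof.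
move=> t0 mp mq me p01 q01 eC De.
pose g := p \- q; have mg : measurable_fun `[0, t] g by exact: measurable_funB.
have p1 s : 0 <= s <= t -> `|p s| <= 1.
  by move=> /p01 ?; rewrite ler_norml; lra.
have q1 s : 0 <= s <= t -> `|q s| <= 1.
  by move=> /q01 ?; rewrite ler_norml; lra.
have g1 s : 0 <= s <= t -> `|g s| <= 1.
  by move=> st; have := p01 _ st; have := q01 _ st; rewrite ler_norml /g/=; lra.
pose D := primitive g.
have DE s : 0 <= s <= t -> primitive p s - primitive q s = D s.
  move=> /andP[s0 st]; rewrite /D /primitive /g RintegralB//.
    by apply: (bounded_integrable_itv _ mp p1); apply: subset_itvl; rewrite bnd_simp.
  by apply: (bounded_integrable_itv _ mq q1); apply: subset_itvl; rewrite bnd_simp.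
rewrite DE ?t0 ?lexx// -subr_le0.
pose G s := D s ^+ 2 - 2 * primitive e s.
rewrite -/(G t).
have -> : 0 = G 0 by rewrite /G /D !primitive0 expr0n/= mulr0 subr0.
apply: (@sublevel_quadratic G 2) => // s u s0 su ut.
have -> : G u - G s = (D u + D s) * (D u - D s) - 2 * (primitive e u - primitive e s).
  by rewrite /G; ring.
rewrite {2}/D (primitive_sub mg g1)// (primitive_sub me eC)//.
have ig := integrable_itv_oc mg g1 s0 ut.
have ie := integrable_itv_oc me eC s0 ut.
rewrite -RintegralZl// -RintegralZl//.
have sub : `]s, u] `<=` `[0, t].
  by move=> r /=; rewrite !in_itv/= => /andP[sr ru]; apply/andP; split; lra.
have mg' : measurable_fun `]s, u] g by exact: measurable_funS mg.
rewrite -RintegralB//; last 2 first.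
- by apply: (integrableZl _ _ ig).
- by apply: (integrableZl _ _ ie).
pose h r := (D u + D s) * g r - 2 * e r.
have mh : measurable_fun `[0, t] h.
  by apply: measurable_funB; apply: measurable_funM => //; exact: measurable_cst.
have hC r : 0 <= r <= t -> `|h r| <= `|D u + D s| + 2 * C.
  move=> rt; rewrite (le_trans (ler_normB _ _))// !normrM (ger0_norm (_ : 0 <= 2))//.
  by rewrite lerD// ?ler_wpM2l ?eC// ler_piMr// g1.
(* By [De] the integrand is at most [(D u + D s - 2 D r) g r], and [D u - D r] and [D s - D r] are
   both at most [u - s] in absolute value because [D] is 1-Lipschitz. *)
have -> : 2 * (u - s) ^+ 2 = (2 * (u - s)) * (u - s) by ring.
apply: (Rintegral_oc_le mh hC) => // r /andP[sr ru].
have rt : 0 <= r <= t by lra.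
have := De _ rt; rewrite DE// -[p r - q r]/(g r) /h.
have := primitive_lip mg g1 s0 sr (le_trans ru ut).
have r0 : 0 <= r by lra.
have := primitive_lip mg g1 r0 ru ut.
have := g1 _ rt; rewrite -!/(D _) !mul1r !ler_norml => /andP[? ?] /andP[? ?] /andP[? ?] ?.
nra.
Qed.

End integral_flow.

(** * The Euler scheme *)

Section euler_scheme.
Variable R : realType.
Local Notation mu := (@lebesgue_measure R).
Variables (alpha b : R).
Implicit Types (f : R -> R) (s t : R).

Definition above (y : R) : R := \1_(`]b, +oo[%classic : set R) y.

Lemma aboveE y : above y = (b < y)%R%:R.
Proof. by rewrite /above indicE mem_setE in_itv/= andbT. Qed.

Lemma above01 y : 0 <= above y <= 1.
Proof. by rewrite aboveE; case: (b < y); rewrite ?lexx ler01. Qed.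

Lemma above_monotone y z : y <= z -> above y <= above z.
Proof.
move=> yz; rewrite !aboveE ler_nat; case: (ltP b y) => // /lt_le_trans-/(_ _ yz) ->//.
Qed.

Lemma measurable_above : measurable_fun setT above.
Proof. exact: measurable_indic. Qed.

Lemma measurable_above_comp d (T : measurableType d) (D : set T) (y : T -> R) :
  measurable_fun D y -> measurable_fun D (above \o y).
Proof. by move=> my; apply: measurableT_comp => //; exact: measurable_above. Qed.

Fixpoint euler f n k : R :=
  if k is k'.+1 then
    euler f n k' + 2 ^- n * above (f (dyad R n k') - alpha * euler f n k')
  else 0.

Definition rate f n k := above (f (dyad R n k) - alpha * euler f n k).

Definition drift f n t :=
  let k := cell n t in euler f n k + (t - dyad R n k) * rate f n k.

Lemma rate01 f n k : 0 <= rate f n k <= 1. Proof. exact: above01. Qed.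

Lemma measurable_cell_fun n (c : nat -> R) : measurable_fun setT (fun s : R => c (cell n s)).
Proof.
have mc : measurable_fun setT (cell n : R -> nat).
  move=> _ Y _; rewrite setTI.
  have -> : cell n @^-1` Y = \bigcup_(k in Y) (cell n @^-1` [set k] : set R).
    by rewrite -preimage_bigcup bigcup_imset1 image_id.
  apply: bigcup_measurable => k _.
  rewrite (_ : _ @^-1` _ = (cell n @^-1` [set l | l <= k]%N) `\` (cell n @^-1` [set l | l <
    k]%N)); last first.
    by apply/seteqP; split=> s /=; [move=> ->; rewrite leqnn ltnn|
      move=> [h /negP]; rewrite -leqNgt => h'; apply/eqP; rewrite eqn_leq h].
  have mle l : measurable (cell n @^-1` [set m | m <= l]%N : set R).
    rewrite (_ : _ @^-1` _ = `]-oo, (dyad R n l.+1)[%classic); first exact: measurable_itv.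
    apply/seteqP; split=> s /=; rewrite in_itv/=.
    + have [s0 ls|s0 _] := leP 0 s; last by rewrite (lt_le_trans s0)// dyad_ge0.
      have /andP[_ h] := cell_itv n s0; apply: (lt_le_trans h).
      by rewrite dyad_le ltnS.
    + have [s0 sl|s0 _] := leP 0 s.
        have /andP[h _] := cell_itv n s0.
        rewrite -ltnS ltnNge -(dyad_le R n) -ltNge; exact: le_lt_trans sl.
      by have := le_cell n (ltW s0); rewrite {2}/cell mul0r truncn0 leqn0 => /eqP ->.
  apply: measurableD => //; case: k => [|k]; last exact: mle.
  by rewrite (_ : _ @^-1` _ = set0)//; apply/seteqP; split.
exact: (measurableT_comp (_ : measurable_fun setT c) mc).
Qed.

(** Writes the interpolated scheme as the primitive of a step function with values in [0, 1], the
    form that [sqr_primitive_sub_le] compares. *)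
Lemma primitive_rate f n t : 0 <= t -> primitive (fun s => rate f n (cell n s)) t = drift f n t.
Proof.
move=> t0.
have mr (u : R) : measurable_fun `[0, u] (fun s => rate f n (cell n s)).
  by apply: measurable_funTS; exact: measurable_cell_fun.
have r1 (u : R) : forall s : R, 0 <= s <= u -> `|rate f n (cell n s)| <= 1.
  by move=> s _; have := rate01 f n (cell n s); rewrite ler_norml; lra.
have step k (u : R) : dyad R n k <= u <= dyad R n k.+1 ->
    primitive (fun s => rate f n (cell n s)) u =
    primitive (fun s => rate f n (cell n s)) (dyad R n k) + (u - dyad R n k) * rate f n k.
  move=> /andP[ku uk]; apply/eqP; rewrite addrC -subr_eq; apply/eqP.
  rewrite (primitive_sub (mr u) (r1 u)) ?dyad_ge0//.
  rewrite -Rintegral_itv_bndo_bndc; last first.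
    apply: (bounded_integrable_itv _ (mr u) (r1 u)) => s /=; rewrite !in_itv/=.
    by move=> /andP[h1 h2]; rewrite (ltW h2) (le_trans (dyad_ge0 R n k) (ltW h1)).
  rewrite (@eq_Rintegral _ _ _ mu _ (cst (rate f n k))); last first.
    move=> s; rewrite inE/= in_itv/= => /andP[h1 h2]; congr rate.
    by apply: cell_def; rewrite (ltW h1) (lt_le_trans h2).
  rewrite Rintegral_cst// mulrC; congr (_ * _).
  have := lebesgue_measure_itv `](dyad R n k), u[; rewrite /= lte_fin => ->.
  by case: ltgtP ku => // -> _; rewrite subrr.
have grid k : primitive (fun s => rate f n (cell n s)) (dyad R n k) = euler f n k.
  elim: k => [|k ih]; first by rewrite /dyad mul0r primitive0.
  rewrite (step k); last by rewrite !dyad_le leqnSn leqnn.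
  by rewrite ih dyadS [X in X * _]addrAC subrr add0r.
have /andP[h1 h2] := cell_itv n t0.
by rewrite (step (cell n t)) ?h1 ?(ltW h2)// grid.
Qed.

Lemma drift_euler f n t : 0 <= t -> 0 <= drift f n t - euler f n (cell n t) <= 2 ^- n.
Proof.
move=> t0; rewrite /drift addrAC subrr add0r.
have /andP[h1 h2] := cell_itv n t0; rewrite dyadS in h2.
by have := rate01 f n (cell n t); nra.
Qed.

Lemma drift_lip f n s u : 0 <= s -> s <= u -> `|drift f n u - drift f n s| <= u - s.
Proof.
move=> s0 su; rewrite -!primitive_rate//; last exact: le_trans su.
rewrite -[leRHS]mul1r; apply: (@primitive_lip _ u) => //.
  by apply: measurable_funTS; exact: measurable_cell_fun.
by move=> r _; have := rate01 f n (cell n r); rewrite ler_norml; lra.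
Qed.

Lemma drift0 f n : drift f n 0 = 0.
Proof. by rewrite /drift /cell mul0r truncn0/= /dyad mul0r subr0 mul0r addr0. Qed.

(** Negative times are included because the joint measurability of [limit_drift], a limsup, asks for
    bounds at every point of [T * R]. *)
Lemma drift_bound f n t : `|drift f n t| <= `|t|.
Proof.
have [t0|t0] := leP 0 t.
  by have := drift_lip f n (lexx 0) t0; rewrite drift0 !subr0 (ger0_norm t0).
rewrite /drift (_ : cell n t = 0%N); last first.
  by have := le_cell n (ltW t0); rewrite {2}/cell mul0r truncn0 leqn0 => /eqP.
rewrite /= /dyad mul0r subr0 add0r normrM ler_piMr//.
by have := rate01 f n 0; rewrite ler_norml; lra.
Qed.

End euler_scheme.

Lemma ae_imp d (T : measurableType d) (R : realType) (mu : {measure set T -> \bar R})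
  (P Q : T -> Prop) : (forall x, P x -> Q x) ->
  {ae mu, forall x, P x} -> {ae mu, forall x, Q x}.
Proof.
move=> PQ [N [mN N0 PN]]; exists N; split => // x nQ; apply: PN => Px.
by apply: nQ; exact: PQ.
Qed.

Lemma ae_and d (T : measurableType d) (R : realType) (mu : {measure set T -> \bar R})
  (P Q : T -> Prop) : {ae mu, forall x, P x} -> {ae mu, forall x, Q x} ->
  {ae mu, forall x, P x /\ Q x}.
Proof.
move=> [N [mN N0 PN]] [M [mM M0 QM]]; exists (N `|` M); split.
- exact: measurableU.
- exact: null_set_setU.
- move=> x /not_andP[h|h]; [left; exact: PN|right; exact: QM].
Qed.

Lemma drift_ge0 (R : realType) (alpha b : R) f n s : 0 <= s -> 0 <= drift alpha b f n s.
Proof.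
move=> s0; rewrite -primitive_rate//; apply: Rintegral_ge0 => r _.
by have /andP[] := rate01 alpha b f n (cell n r).
Qed.

(** * Convergence of the Euler scheme along a path *)

Section euler_convergence.
Variable R : realType.
Local Notation mu := (@lebesgue_measure R).
Variables (alpha b : R) (f : R -> R).
Hypotheses (alpha0 : 0 < alpha) (cf : cadlag f).
Implicit Types (s t : R).

Lemma measurable_cadlag t : measurable_fun `[0, t] f.
Proof.
apply: (@measurable_fun_cvg _ _ _ _ (fun n s => f (dyad R n (cell n s).+1))).
  by move=> n; apply: measurable_funTS;
    exact: (measurable_cell_fun n (fun k => f (dyad R n k.+1))).
move=> s /=; rewrite in_itv/= => /andP[s0 _].
by apply: cvg_right_grid => //; case: cf => + _; exact.
Qed.

Lemma cvg_left_grid s : 0 <= s -> (0 < s -> f u @[u --> s^'-] --> f s) ->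
  (fun n => f (dyad R n (cell n s))) @ \oo --> f s.
Proof.
move=> s0 fs; have [s00|sn0] := eqVneq s 0.
  apply: cvg_near_cst; apply: nearW => n.
  by rewrite s00 /cell mul0r truncn0 /dyad mul0r.
have {}s0 : 0 < s by rewrite lt_neqAle eq_sym sn0.
apply/cvgrPdist_lt => e e0.
have [r r0 H] := cvg_left_dist e0 (fs s0).
have [N _ HN] : \forall n \near \oo, s - r < dyad R n (cell n s).
  by apply: (cvgr_gt s); [exact: cvg_dyad_cell (ltW s0)|rewrite ltrBlDr ltrDl].
exists N => // n /= Nn; have := HN n Nn; have /andP[] := cell_itv n (ltW s0).
rewrite le_eqVlt => /predU1P[-> _ _|h _ h']; first by rewrite subrr normr0.
exact: H.
Qed.

Lemma cvg_left_grid_ae t : {ae mu, forall s, `[0, t]%classic s ->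
  (fun n => f (dyad R n (cell n s))) @ \oo --> f s}.
Proof.
have cD := cadlag_discontinuities_countable cf.
exists [set s : R | 0 < s /\ ~ (f u @[u --> s^'-] --> f s)]; split.
- exact: countable_measurable.
- exact: countable_lebesgue_measure0.
- move=> s /= /not_implyP[]; rewrite in_itv/= => /andP[s0 _] ncv.
  apply: contrapT => /not_andP h; apply: ncv; apply: cvg_left_grid => // s1.
  by case: h => // /contrapT.
Qed.

(** Bounds the defect of monotonicity at level [n]: [2^-n] for freezing the drift at the grid point,
    the second term for freezing the path there. The cap [t], which also bounds the gap between two
    drifts, makes dominated convergence immediate. *)
Definition grid_error t n s :=
  Num.min t (2 ^- n + `|f (dyad R n (cell n s)) - f s| / alpha).

Lemma measurable_grid_error t n : measurable_fun `[0, t] (grid_error t n).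
Proof.
apply: measurable_minr; first exact: measurable_cst.
apply: measurable_funD; first exact: measurable_cst.
apply: measurable_funM; last exact: measurable_cst.
apply: measurableT_comp => //; apply: measurable_funB; last exact: measurable_cadlag.
by apply: measurable_funTS; exact: (measurable_cell_fun n (fun k => f (dyad R n k))).
Qed.

Lemma grid_error_ge0 t n s : 0 <= t -> 0 <= grid_error t n s.
Proof.
move=> t0; rewrite le_min t0/= addr_ge0 ?invr_ge0 ?exprn_ge0// divr_ge0//.
exact: ltW.
Qed.

Lemma grid_error_bound t n s : 0 <= t -> `|grid_error t n s| <= t.
Proof.
by move=> t0; rewrite ger0_norm ?grid_error_ge0// ge_min lexx.
Qed.

(** A cadlag path is left-continuous off a countable set, so the integrand tends to 0 almost
    everywhere. *)
Lemma cvg_primitive_grid_error t : 0 <= t ->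
  (fun n => primitive (grid_error t n) t) @ \oo --> 0.
Proof.
move=> t0.
have [|||||_ _] := @dominated_convergence _ _ _ mu `[0, t] (measurable_itv _)
  (fun n s => (grid_error t n s)%:E) (cst 0%E) (cst t%:E).
- by move=> n; apply/measurable_EFinP; exact: measurable_grid_error.
- exact: measurable_cst.
- apply: ae_imp (cvg_left_grid_ae t) => s fs st; have {}fs := fs st.
  apply: cvg_EFin; first by apply: nearW.
  rewrite /comp/=; apply: (@squeeze_cvgr _ _ _ _ (cst 0) (fun n =>
    2 ^- n + `|f (dyad R n (cell n s)) - f s| / alpha)).
  + by apply: nearW => n /=; rewrite grid_error_ge0// ge_min lexx orbT.
  + exact: cvg_cst.
  + rewrite -[X in _ --> X](addr0 0); apply: cvgD; first exact: pow2_inv_cvg0.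
    rewrite -(mul0r alpha^-1) -(normr0 R); apply: cvgMl; apply: cvg_norm.
    by rewrite -(subrr (f s)); apply: cvgB => //; exact: cvg_cst.
- apply: (@bounded_integrable_itv _ _ t t (cst t)) => //.
  by move=> s _; rewrite /= ger0_norm.
- by apply: aeW => s n _; rewrite /= lee_fin grid_error_bound.
rewrite integral0 => /fine_cvgP[_]; exact.
Qed.

Lemma sqr_drift_sub_le t n m : 0 <= t ->
  (drift alpha b f n t - drift alpha b f m t) ^+ 2 <=
  2 * (primitive (grid_error t n) t + primitive (grid_error t m) t).
Proof.
move=> t0; rewrite -!primitive_rate//.
have ie k : mu.-integrable `[0, t] (EFin \o grid_error t k).
  apply: (bounded_integrable_itv _ (@measurable_grid_error t k)) => // s _.
  exact: grid_error_bound.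
rewrite [X in 2 * X](_ : _ = primitive (grid_error t n \+ grid_error t m) t); last first.
  by rewrite /primitive -RintegralD.
apply: (@sqr_primitive_sub_le _ t (t + t)) => //.
- by apply: measurable_funTS; exact: measurable_cell_fun.
- by apply: measurable_funTS; exact: measurable_cell_fun.
- by apply: measurable_funD; exact: measurable_grid_error.
- by move=> s _; exact: rate01.
- by move=> s _; exact: rate01.
- by move=> s _; rewrite (le_trans (ler_normD _ _))// lerD// grid_error_bound.
move=> s /andP[s0 st]; rewrite !primitive_rate//=.
wlog : n m {ie} / drift alpha b f m s <= drift alpha b f n s.
  move=> H; have [|/ltW] := leP (drift alpha b f m s) (drift alpha b f n s); first exact: H.
  by move=> /H; rewrite [leRHS]addrC -mulrNN !opprB.
move=> mn; rewrite -subr_ge0 in mn.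
have Dt : drift alpha b f n s - drift alpha b f m s <= t.
  have := drift_bound alpha b f n s; rewrite ler_norml (ger0_norm s0) => /andP[_ h].
  by have := drift_ge0 alpha b f m s0; lra.
have en := grid_error_ge0 n s t0; have em := grid_error_ge0 m s t0.
have := drift_euler alpha b f n s0; have := drift_euler alpha b f m s0.
have := rate01 alpha b f n (cell n s); have := rate01 alpha b f m (cell m s).
have [pq|pq] := leP (rate alpha b f n (cell n s)) (rate alpha b f m (cell m s)).
  by move=> *; nra.
move: pq; rewrite {1 2}/rate => pq.
have {}pq : f (dyad R m (cell m s)) - alpha * euler alpha b f m (cell m s) <
  f (dyad R n (cell n s)) - alpha * euler alpha b f n (cell n s).
  by rewrite ltNge; apply: contraTN pq => /(above_monotone b); rewrite -leNgt.
move: (rate _ _ _ n _) (rate _ _ _ m _) => p q q01 p01.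
move: mn Dt pq; set D := drift _ _ _ n s; set E := drift _ _ _ m s.
move: (euler _ _ _ n _) (euler _ _ _ m _) => x y DE Dt xy hm hn.
apply: (@le_trans _ _ (D - E)); first by nra.
rewrite /grid_error; set u := f (dyad R n _) in xy *; set v := f (dyad R m _) in xy *.
have xyuv : x - y <= `|u - f s| / alpha + `|v - f s| / alpha.
  rewrite -mulrDl ler_pdivlMr// mulrC.
  have := ler_norm (u - f s); have := ler_norm (f s - v); rewrite (distrC (f s)); lra.
have a1 : 0 <= `|u - f s| / alpha by rewrite divr_ge0// ltW.
have a2 : 0 <= `|v - f s| / alpha by rewrite divr_ge0// ltW.
have n0 : 0 <= 2 ^- n :> R by rewrite invr_ge0 exprn_ge0.
have m0 : 0 <= 2 ^- m :> R by rewrite invr_ge0 exprn_ge0.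
by rewrite !minElt; do 2 case: ifP => _; lra.
Qed.

Lemma is_cvg_drift t : 0 <= t -> cvg (drift alpha b f n t @[n --> \oo]).
Proof.
move=> t0; apply/cauchy_cvgP; apply: cauchy_exP => e e0.
have e2 : 0 < e ^+ 2 / 4 by rewrite divr_gt0// exprn_gt0.
have [N _ HN] : \forall n \near \oo, primitive (grid_error t n) t < e ^+ 2 / 4.
  by apply: (cvgr_lt 0) => //; exact: cvg_primitive_grid_error.
exists (drift alpha b f N t); exists N => // n /= Nn.
rewrite /ball/= -ltr_sqr ?nnegrE ?(ltW e0)// real_normK ?num_real//.
apply: le_lt_trans (sqr_drift_sub_le N n t0) _.
have := HN N (leqnn N); have := HN n Nn; rewrite /=; lra.
Qed.

(* A limsup, so that it is measurable for the uncompleted filtration also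
   where the path is not cadlag. *)
Definition limit_drift t := limn_sup (fun n => drift alpha b f n t).

Lemma cvg_drift t : 0 <= t -> drift alpha b f n t @[n --> \oo] --> limit_drift t.
Proof.
move=> t0; have cd := is_cvg_drift t0.
by rewrite /limit_drift /limn_sup (cvg_lim _ (cvg_sups cd)).
Qed.

Lemma limit_drift_lip s u : 0 <= s -> s <= u ->
  0 <= limit_drift u - limit_drift s <= u - s.
Proof.
move=> s0 su; have u0 := le_trans s0 su.
have cu : drift alpha b f n u - drift alpha b f n s @[n --> \oo] --> limit_drift u -
  limit_drift s.
  by apply: cvgB; exact: cvg_drift.
apply/andP; split.
- rewrite -(cvg_lim (@Rhausdorff R) cu); apply: limr_ge; first by apply/cvg_ex; eexists;
  exact: cu.
  apply: nearW => n.
  rewrite -!primitive_rate// (@primitive_sub _ u 1)//.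
  + by apply: Rintegral_ge0 => r _; have /andP[] := rate01 alpha b f n (cell n r).
  + by apply: measurable_funTS; exact: measurable_cell_fun.
  + by move=> r _; have := rate01 alpha b f n (cell n r); rewrite ler_norml; lra.
- rewrite -(cvg_lim (@Rhausdorff R) cu); apply: limr_le; first by apply/cvg_ex; eexists;
  exact: cu.
  apply: nearW => n.
  by have := drift_lip alpha b f n s0 su; rewrite ler_norml => /andP[].
Qed.

Lemma measurable_limit_drift t : measurable_fun `[0, t] limit_drift.
Proof.
apply: (@measurable_fun_cvg _ _ _ _ (fun n s => drift alpha b f n s)); last first.
  by move=> s /=; rewrite in_itv/= => /andP[s0 _]; exact: cvg_drift.
move=> n; apply: measurable_funTS; apply: measurable_funD.
  exact: (measurable_cell_fun n (euler alpha b f n)).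
apply: measurable_funM; last exact: (measurable_cell_fun n (rate alpha b f n)).
apply: measurable_funB => //; exact: (measurable_cell_fun n (dyad R n)).
Qed.

(** The indicator is discontinuous only at [b]. Off that level the rates of the scheme are
    eventually constant in [n], and dominated convergence passes [primitive_rate] to the limit. *)
Lemma limit_drift_eq t : 0 <= t ->
  {ae mu, forall s, `[0, t]%classic s -> f s - alpha * limit_drift s != b} ->
  limit_drift t = \int[mu]_(s in `[0, t]) above b (f s - alpha * limit_drift s).
Proof.
move=> t0 nb.
have [|||||If _ h] := @dominated_convergence _ _ _ mu `[0, t] (measurable_itv _)
  (fun n s => (rate alpha b f n (cell n s))%:E)
  (fun s => (above b (f s - alpha * limit_drift s))%:E) (cst 1%E).
- move=> n; apply/measurable_EFinP; apply: measurable_funTS; exact: measurable_cell_fun.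
- apply/measurable_EFinP; apply: (measurable_above_comp b (y := fun s =>
  f s - alpha * limit_drift s)).
  apply: measurable_funB; first exact: measurable_cadlag.
  by apply: measurable_funM; [exact: measurable_cst|exact: measurable_limit_drift].
- apply: ae_imp (ae_and nb (cvg_left_grid_ae t)) => s [ns fs] st.
  have {}fs := fs st; have {}ns := ns st; move: st; rewrite /= in_itv/= => /andP[s0 _].
  apply: cvg_EFin; first by apply: nearW.
  have ce : euler alpha b f n (cell n s) @[n --> \oo] --> limit_drift s.
    under eq_fun => n do rewrite -[euler _ _ _ _ _](subKr (drift alpha b f n s)).
    rewrite -[limit_drift s]subr0; apply: cvgB; first exact: cvg_drift.
    apply: (@squeeze_cvgr _ _ _ _ (cst 0) (fun n => 2 ^- n)).
    + by apply: nearW => n; exact: drift_euler.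
    + exact: cvg_cst.
    + exact: pow2_inv_cvg0.
  have cy : f (dyad R n (cell n s)) - alpha * euler alpha b f n (cell n s) @[n --> \oo] -->
      f s - alpha * limit_drift s.
    by apply: cvgB => //; apply: cvgMr.
  apply: cvg_near_cst; move: ns; rewrite neq_lt => /orP[h|h].
  + apply: filterS (cvgr_lt _ cy _ h) => n /= hn.
    by rewrite /rate !aboveE !ltNge (ltW hn) (ltW h).
  + apply: filterS (cvgr_gt _ cy _ h) => n /= hn.
    by rewrite /rate !aboveE h hn.
- apply: (@bounded_integrable_itv _ _ t 1 (cst 1)) => //.
  by move=> s _; rewrite /= normr1.
- apply: aeW => s n _; rewrite /= lee_fin.
  by have := rate01 alpha b f n (cell n s); rewrite ler_norml; lra.
move: h; rewrite -(fineK (integrable_fin_num _ If))// => /fine_cvgP[_ h].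
apply: (cvg_unique _ (cvg_drift t0)) => //=.
by under eq_fun => n do rewrite -primitive_rate//.
Qed.

End euler_convergence.

Lemma measurable_bool_natr d (T : measurableType d) (R : realType) (D : set T)
  (p : T -> bool) : measurable_fun D p -> measurable_fun D (fun x => (p x)%:R : R).
Proof.
by move=> mp; apply: (@measurableT_comp _ _ _ _ _ _ (fun c : bool => c%:R : R)).
Qed.

(** * Estimates on the characteristic exponent *)

Section levy_khintchine_bounds.
Variables (R : realType) (Pi : {measure set R -> \bar R}).
Hypothesis lPi : levy_measure Pi.
Implicit Types theta z : R.

Definition cutoff z : R := Num.min 1 (z ^+ 2).

Lemma cutoff_ge0 z : 0 <= cutoff z.
Proof. by rewrite le_min ler01 sqr_ge0. Qed.

Lemma measurable_cutoff : measurable_fun setT cutoff.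
Proof. by apply: measurable_minr => //; exact: measurable_funX. Qed.

Lemma integrable_cutoff (C : R) : Pi.-integrable setT (EFin \o (fun z => C * cutoff z)).
Proof.
have i1 : Pi.-integrable setT (EFin \o cutoff).
  apply/integrableP; split; first by apply/measurable_EFinP; exact: measurable_cutoff.
  rewrite (eq_integral (fun z => (cutoff z)%:E)); first exact: lPi.2.
  by move=> z _; rewrite /= ger0_norm// cutoff_ge0.
exact: (integrableZl _ _ i1).
Qed.

Lemma integrable_le_cutoff (C : R) (g : R -> R) : measurable_fun setT g ->
  (forall z, `|g z| <= C * cutoff z) -> Pi.-integrable setT (EFin \o g).
Proof.
move=> mg gC; apply: (le_integrable _ _ _ (integrable_cutoff C)) => //.
  exact/measurable_EFinP.
by move=> z _; rewrite /= lee_fin (le_trans (gC z))// ler_norm.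
Qed.

(** [versine] and [sin_defect] are the jump integrands of the real and imaginary parts of
    [levy_exponent]. *)
Definition versine theta z : R := 1 - cos (theta * z).

Definition sin_defect theta z : R :=
  theta * z * \1_(`]-1, 1[%classic : set R) z - sin (theta * z).

Lemma measurable_mul_cos theta : measurable_fun setT (fun z : R => cos (theta * z)).
Proof.
apply: measurableT_comp; first exact: (continuous_measurable_fun (@continuous_cos R)).
by apply: measurable_funM => //; exact: measurable_cst.
Qed.

Lemma measurable_mul_sin theta : measurable_fun setT (fun z : R => sin (theta * z)).
Proof.
apply: measurableT_comp; first exact: (continuous_measurable_fun (@continuous_sin R)).
by apply: measurable_funM => //; exact: measurable_cst.
Qed.

Lemma measurable_versine theta : measurable_fun setT (versine theta).
Proof. by apply: measurable_funB => //; exact: measurable_mul_cos. Qed.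

Lemma measurable_sin_defect theta : measurable_fun setT (sin_defect theta).
Proof.
apply: measurable_funB; last exact: measurable_mul_sin.
apply: measurable_funM; last exact: measurable_indic.
by apply: measurable_funM => //; exact: measurable_cst.
Qed.

Lemma versine_ge0 theta z : 0 <= versine theta z.
Proof. by rewrite subr_ge0 cos_le1. Qed.

Lemma versine_le_cutoff theta z : `|versine theta z| <= (2 + theta ^+ 2) * cutoff z.
Proof.
rewrite ger0_norm ?versine_ge0// /versine /cutoff.
have := cos_geN1 (theta * z); have := cos_ge_sqr (theta * z); rewrite exprMn.
move: (cos _) (z ^+ 2) (theta ^+ 2) (sqr_ge0 theta) (sqr_ge0 z) => c v u u0 v0.
have := mulr_ge0 u0 v0.
by have [?|?] := leP 1 v; lra.
Qed.

Lemma indic_lt1 z : \1_(`]-1, 1[%classic : set R) z = (`|z| < 1)%R%:R :> R.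
Proof. by rewrite indicE mem_setE in_itv/= ltr_norml. Qed.

Lemma sin_defect_le_cutoff theta z : `|sin_defect theta z| <= (1 + theta ^+ 2) * cutoff z.
Proof.
rewrite /sin_defect indic_lt1 /cutoff.
have [z1|z1] := ltP `|z| 1.
  have z2 : z ^+ 2 < 1 by rewrite -real_normK ?num_real// expr_lt1.
  rewrite mulr1 (min_idPr (ltW z2)).
  apply: (le_trans (ler_norm_sub_sin _)); rewrite exprMn.
  by have := sqr_ge0 z; nra.
rewrite mulr0 sub0r normrN (min_idPl _); last first.
  by rewrite -(real_normK (num_real z)) expr_ge1.
by rewrite mulr1 (le_trans (sin_max _))// lerDl sqr_ge0.
Qed.

Lemma integrable_versine theta : Pi.-integrable setT (EFin \o versine theta).
Proof.
apply: integrable_le_cutoff (@measurable_versine _) _; exact: versine_le_cutoff.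
Qed.

Lemma integrable_sin_defect theta : Pi.-integrable setT (EFin \o sin_defect theta).
Proof.
apply: integrable_le_cutoff (@measurable_sin_defect _) _; exact: sin_defect_le_cutoff.
Qed.

Lemma continuous_int_sin_defect : continuous (fun theta => \int[Pi]_z sin_defect theta z).
Proof.
move=> theta; set K := `|theta| + 1.
have th : theta \in (`](- K), K[%classic : set R).
  rewrite mem_setE in_itv/= -ltr_norml /K ltrDl ltr01//.
apply: (@continuity_under_integral _ _ _ Pi sin_defect setT _ (- K) K _ _
  (fun z => (1 + K ^+ 2) * cutoff z)) => //.
- by move=> x _; exact: integrable_sin_defect.
- apply: aeW => z _ x _; rewrite /sin_defect.
  apply: cvgB.
    by apply: cvgMl; apply: cvgMl; exact: cvg_id.
  apply: continuous_comp; last exact: continuous_sin.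
  by apply: cvgMl; exact: cvg_id.
- exact: integrable_cutoff.
- move=> x; rewrite /= in_itv/= -ltr_norml => xK; apply: aeW => z _.
  apply: (le_trans (sin_defect_le_cutoff _ _)); apply: ler_wpM2r; first exact: cutoff_ge0.
  by rewrite lerD2l -(real_normK (num_real x)) lerXn2r ?nnegrE// ltW// (le_lt_trans _ xK).
Qed.


Lemma sin_defectN theta z : sin_defect theta (- z) = - sin_defect theta z.
Proof. by rewrite /sin_defect !indic_lt1 normrN mulrN sinN mulNr opprD. Qed.

Section one_sided.
(* eps is the sign of the half-line carrying infinitely many jumps. *)
Variable eps : R.
Hypothesis eps_sign : eps = 1 \/ eps = -1.
Hypothesis finite_other_side : (Pi [set z | (eps * z < 0)%R] < +oo)%E.
Hypothesis infinite_variation : (\int[Pi]_z (Num.min 1 `|z|)%:E = +oo)%E.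

Let inner (delta z : R) : R := eps * z * ((delta <= eps * z) && (eps * z < 1))%R%:R.
Let other (z : R) : R := \1_[set z : R | eps * z < 0] z.
Let outer (z : R) : R := (1 <= `|z|)%R%:R.

(** At frequency [kappa / r] the compensator contributes [kappa z], free of [r], against a sine term
    of size at most [r]. On the inner band [r <= kappa z / 2], so half of [kappa z] survives; nearer
    to 0 on the same side [sin y <= y] keeps the sign. The wrong side loses at most [2 kappa], and
    jumps of size at least 1 lose at most [r <= 1]. *)
Lemma sin_defect_ge (kappa delta r z : R) : 0 < kappa -> 0 < r -> r <= 1 ->
  0 < delta -> 2 * r <= kappa * delta ->
  kappa / 2 * inner delta z - 2 * kappa * other z - outer z <=
  eps * (r * sin_defect (kappa / r) z).
Proof.
move=> k0 r0 r1 d0 rk; rewrite /inner /other /outer indicE.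
rewrite (_ : z \in _ = (eps * z < 0)); last by apply/idP/idP; rewrite inE.
have -> : eps * (r * sin_defect (kappa / r) z) = r * sin_defect (kappa / r) (eps * z).
  by case: eps_sign => ->; rewrite ?mul1r// !mulN1r sin_defectN mulrN.
have -> : `|z| = `|eps * z|.
  by case: eps_sign => ->; rewrite ?mul1r// mulN1r normrN.
have b1 : true%:R = 1 :> R by []; have b0 : false%:R = 0 :> R by [].
move: (eps * z) => {z} z; rewrite /sin_defect indic_lt1 mulrBr.
have E : r * (kappa / r * z) = kappa * z by field; apply: lt0r_neq0.
have [z1|z1] := ltP `|z| 1; last first.
  rewrite (_ : (delta <= z < 1) = false); last first.
    by move: z1; rewrite ler_normr; case: ltP => //=; lra.
  have := sin_le1 (kappa / r * z).
  by case: (z < 0); rewrite ?b0 ?b1 !mulr0 ?mulr1 => ?; nra.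
rewrite b1 b0 mulr1 E subr0.
have rs : r * sin (kappa / r * z) <= kappa * `|z|.
  have -> : kappa * `|z| = r * `|kappa / r * z|.
    by rewrite normrM (ger0_norm (divr_ge0 (ltW k0) (ltW r0))); field; apply: lt0r_neq0.
  by rewrite ler_wpM2l ?(ltW r0)// (le_trans (ler_norm _))// ler_norm_sin.
have [z0|z0] := ltP z 0.
  rewrite (_ : (delta <= z < 1) = false); last by apply/negP; lra.
  rewrite b0 b1; move: rs z1; rewrite ltr0_norm// => rs z1; nra.
rewrite ger0_norm// in rs z1; rewrite b0 mulr0 subr0 z1 andbT.
have [dz|dz] := leP delta z; last by rewrite b0 !mulr0; lra.
have := sin_le1 (kappa / r * z) => s1.
have : kappa * delta <= kappa * z by rewrite ler_pM2l.
by move: rs s1; rewrite b1 mulr1; move: (sin _) => w rs s1; nra.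
Qed.

Lemma integrable_inner delta : 0 < delta -> Pi.-integrable setT (EFin \o inner delta).
Proof.
(* On the band, [y <= y^2 / delta]. *)
move=> d0; apply: (@integrable_le_cutoff delta^-1).
- apply: measurable_funM.
    by apply: measurable_funM => //; exact: measurable_cst.
  apply: measurable_bool_natr; apply: measurable_and.
    by apply: measurable_fun_ler => //; apply: measurable_funM => //; exact: measurable_cst.
  by apply: measurable_fun_ltr => //; apply: measurable_funM => //; exact: measurable_cst.
- move=> z; rewrite /inner; have [/andP[h1 h2]|_] := boolP (_ && _); last first.
    by rewrite mulr0 normr0 mulr_ge0 ?cutoff_ge0// invr_ge0 ltW.
  have -> : cutoff z = (eps * z) ^+ 2.
    have -> : cutoff z = cutoff (eps * z).
      by rewrite /cutoff exprMn; case: eps_sign => ->; rewrite ?sqrrN expr1n mul1r.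
    by rewrite /cutoff min_r// expr_le1// ?ltW// (lt_le_trans d0).
  move: (eps * z) h1 h2 => y h1 h2; rewrite mulr1 ger0_norm ?(le_trans (ltW d0))//.
  by rewrite mulrC ler_pdivlMr// mulrC expr2 ler_wpM2r// (le_trans (ltW d0)).
Qed.

Lemma measurable_other_set : measurable [set z : R | eps * z < 0].
Proof.
rewrite (_ : [set _ | _] = (fun z : R => eps * z) @^-1` `]-oo, 0[%classic); last first.
  by apply/seteqP; split=> z /=; rewrite in_itv.
rewrite -[X in measurable X]setTI.
have : measurable_fun setT (fun z : R => eps * z).
  by apply: measurable_funM => //; exact: measurable_cst.
by apply => //; exact: measurable_itv.
Qed.

Lemma integrable_other : Pi.-integrable setT (EFin \o other).
Proof.
apply/integrableP; split.
  by apply/measurable_EFinP; apply: measurable_indic; exact: measurable_other_set.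
under eq_integral do rewrite /= ger0_norm ?indicE//.
rewrite (_ : (\int[Pi]_x _)%E = \int[Pi]_x (\1_[set z : R | (eps * z < 0)%R] x)%:E)%E; last by [].
rewrite integral_indic ?setIT//; exact: measurable_other_set.
Qed.

Lemma integrable_outer : Pi.-integrable setT (EFin \o outer).
Proof.
apply: (@integrable_le_cutoff 1).
- by apply: measurable_bool_natr; apply: measurable_fun_ler.
- move=> z; rewrite /outer mul1r ger0_norm ?ler0n//.
  have [h|h] := leP 1 `|z|; last exact: cutoff_ge0.
  by rewrite /cutoff min_l// -(real_normK (num_real z)) expr_ge1.
Qed.

(** Otherwise monotone convergence as [delta] decreases to 0 makes [|z|] integrable over the small
    jumps of sign [eps]. Jumps of the other sign and large jumps have finite mass, so [min(1, |z|)]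
    would be integrable. *)
Lemma inner_unbounded (L : R) :
  exists2 delta : R, 0 < delta & L <= \int[Pi]_z inner delta z.
Proof.
apply: contrapT => nL.
have {}nL delta : 0 < delta -> (\int[Pi]_z (inner delta z)%:E <= L%:E)%E.
  move=> d0; rewrite -(fineK (integrable_fin_num _ (integrable_inner d0)))// lee_fin.
  by rewrite leNgt; apply/negP => h; apply: nL; exists delta => //; exact: ltW.
have d0 (n : nat) : 0 < n.+1%:R^-1 :> R by rewrite invr_gt0.
pose full z : R := eps * z * ((0 < eps * z) && (eps * z < 1))%R%:R.
have inner0 delta z : 0 < delta -> 0 <= inner delta z.
  move=> dd; rewrite /inner; have [/andP[h _]|_] := boolP (_ && _); last by rewrite mulr0.
  by rewrite mulr1 (le_trans (ltW dd)).
have cv : (\int[Pi]_z (inner n.+1%:R^-1 z)%:E)%E @[n --> \oo] --> (\int[Pi]_z (full z)%:E)%E.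
  have -> : (\int[Pi]_z (full z)%:E = \int[Pi]_z (limn (fun n => (inner n.+1%:R^-1 z)%:E)))%E.
    apply: eq_integral => z _; apply/esym/cvg_lim => //.
    apply: cvg_near_cst; rewrite /full.
    have [y0|y0] := ltP 0 (eps * z); last first.
      apply: nearW => n; rewrite /inner.
      by rewrite (_ : (_ <= eps * z) = false)//; apply/negP => /(lt_le_trans (d0 n)); lra.
    have [N hN] := ltr_add_invr y0; rewrite add0r in hN.
    exists N => // n /= Nn; rewrite /inner (_ : n.+1%:R^-1 <= _)//.
    by rewrite (le_trans _ (ltW hN))// lef_pV2 ?posrE// ler_nat.
  apply: cvg_monotone_convergence => //.
  - by move=> n; have /integrableP[] := integrable_inner (d0 n).
  - by move=> n z _; rewrite lee_fin inner0.
  - move=> z _ n m nm; rewrite lee_fin /inner.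
    have [/andP[h1 h2]|_] := boolP ((n.+1%:R^-1 <= _) && _); last first.
      by rewrite mulr0; exact: (inner0 m.+1%:R^-1 z).
    rewrite h2 (_ : m.+1%:R^-1 <= _)// (le_trans _ h1)// lef_pV2 ?posrE// ler_nat.
    by rewrite ltnS.
have fullL : (\int[Pi]_z (full z)%:E <= L%:E)%E.
  rewrite -(cvg_lim _ cv)//; apply: lime_le; first by apply/cvg_ex; eexists; exact: cv.
  by apply: nearW => n; exact: nL.
have mfull : measurable_fun setT full.
  apply: measurable_funM.
    by apply: measurable_funM => //; exact: measurable_cst.
  apply: measurable_bool_natr; apply: measurable_and.
    by apply: measurable_fun_ltr => //; apply: measurable_funM => //; exact: measurable_cst.
  by apply: measurable_fun_ltr => //; apply: measurable_funM => //; exact: measurable_cst.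
have full0 z : 0 <= full z.
  rewrite /full; have [/andP[h _]|_] := boolP (_ && _); last by rewrite mulr0.
  by rewrite mulr1 ltW.
have ifull : Pi.-integrable setT (EFin \o full).
  apply/integrableP; split; first exact/measurable_EFinP.
  under eq_integral do rewrite /= ger0_norm//.
  by apply: (le_lt_trans fullL); rewrite ltry.
have isum : Pi.-integrable setT (EFin \o (full \+ other \+ outer)).
  have := integrableD measurableT (integrableD measurableT ifull integrable_other)
    integrable_outer.
  by apply: eq_integrable.
have/integrableP[_] : Pi.-integrable setT (EFin \o (fun z : R => Num.min 1 `|z|)).
  apply: (le_integrable _ _ _ isum) => //.
    apply/measurable_EFinP; apply: measurable_minr => //; exact: normr_measurable.
  move=> z _; rewrite /= lee_fin ger0_norm; last by rewrite le_min ler01 normr_ge0.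
  apply: le_trans (ler_norm _); rewrite /= /full /other /outer indicE.
  rewrite (_ : z \in _ = (eps * z < 0)); last by apply/idP/idP; rewrite inE.
  have -> : `|z| = `|eps * z|.
    by case: eps_sign => ->; rewrite ?mul1r// mulN1r normrN.
  move: (eps * z) => y; have [y1|y1] := leP 1 `|y|.
    by case: (y < 0); case: (ltP 0 y); case: (ltP y 1); rewrite /= ?mulr0 ?mulr1; lra.
  have [y0|y0|->] := ltgtP y 0; rewrite /= ?mul0r ?normr0 ?mulr0 ?addr0 ?add0r//.
    exact: ltW.
  by move: y1; rewrite gtr0_norm// => ->; rewrite mulr1.
rewrite (eq_integral (fun z : R => (Num.min 1 `|z|)%:E)) ?infinite_variation// => z _.
by rewrite /= ger0_norm// le_min ler01 normr_ge0.
Qed.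

(** The losses in [sin_defect_ge] integrate to constants free of [delta] and [r]. Hence [delta] is
    chosen to make the gain exceed them by [L], and [r] only afterwards, small against
    [kappa delta]. *)
Lemma sin_defect_diverges (kappa L : R) : 0 < kappa ->
  exists2 r0 : R, 0 < r0 & forall r : R, 0 < r -> r < r0 ->
    L <= `|r * \int[Pi]_z sin_defect (kappa / r) z|.
Proof.
move=> k0; have k2 : 0 < kappa / 2 by rewrite divr_gt0.
set Bo := \int[Pi]_z other z; set Co := \int[Pi]_z outer z.
have [delta d0 hd] := inner_unbounded ((L + 2 * kappa * Bo + Co) / (kappa / 2)).
exists (Num.min 1 (kappa * delta / 2)).
  by rewrite lt_min ltr01 divr_gt0// mulr_gt0.
move=> r r0; rewrite lt_min => /andP[r1 rk].
have := integrable_inner d0; have := integrable_other; have := integrable_outer => i1 i2 i3.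
have j2 : Pi.-integrable setT (EFin \o (fun z =>
  2 * kappa * other z)) by exact: (integrableZl _ _ i2).
have j3 : Pi.-integrable setT (EFin \o (fun z =>
  kappa / 2 * inner delta z)) by exact: (integrableZl _ _ i3).
have is0 := integrable_sin_defect (kappa / r).
have is1 : Pi.-integrable setT (EFin \o (fun z =>
  r * sin_defect (kappa / r) z)) by exact: (integrableZl _ _ is0).
have is2 : Pi.-integrable setT (EFin \o (fun z =>
  eps * (r * sin_defect (kappa / r) z))) by exact: (integrableZl _ _ is1).
have j32 : Pi.-integrable setT (EFin \o (fun z =>
  kappa / 2 * inner delta z - 2 * kappa * other z)) by exact: (integrableB _ j3 j2).
have : L <= eps * (r * \int[Pi]_z sin_defect (kappa / r) z).
  rewrite -RintegralZl// -RintegralZl//.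
  apply: (@le_trans _ _ (\int[Pi]_z (kappa / 2 * inner delta z - 2 * kappa * other z - outer z))).
    rewrite RintegralB// RintegralB// RintegralZl// RintegralZl// -/Bo -/Co.
    by move: hd; rewrite ler_pdivrMr// [X in _ <= X]mulrC; lra.
  apply: le_Rintegral => //; first exact: (integrableB _ j32 i1).
  by move=> z _; apply: sin_defect_ge => //; [exact: ltW|lra].
have -> : `|r * \int[Pi]_z sin_defect (kappa / r) z| = `|eps * (r * \int[Pi]_z sin_defect
  (kappa / r) z)|.
  by case: eps_sign => ->; rewrite ?mul1r// mulN1r normrN.
by move=> h; apply: (le_trans h); exact: ler_norm.
Qed.

End one_sided.

End levy_khintchine_bounds.

(** * Small increments of the Levy process *)

Section small_increments.
Variables (d : measure_display) (T : measurableType d) (R : realType).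
Variables (P : probability T R) (X : R -> T -> R).
Variables (gamma sigma : R) (Pi : {measure set R -> \bar R}).
Hypothesis mX : forall t : R, 0 <= t -> measurable_fun setT (X t).
Hypothesis triplet : levy_triplet P X gamma sigma Pi.

Let lPi : levy_measure Pi. Proof. by case: triplet. Qed.

Definition psi_re (theta : R) : R :=
  sigma ^+ 2 * theta ^+ 2 / 2 + \int[Pi]_z versine theta z.
Definition psi_im (theta : R) : R := - (gamma * theta) + \int[Pi]_z sin_defect theta z.

Lemma expectation_cos (t theta : R) : 0 <= t ->
  \int[P]_w cos (theta * (X t w - X 0 w)) = expR (- (t * psi_re theta)) * cos (t * psi_im theta).
Proof.
move=> t0; case: triplet => _ _ /(_ t theta t0) /(congr1 (@complex.Re R)).
rewrite /= => ->; rewrite !mul0r subr0 ?addr0 ?add0r cosN.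
by [].
Qed.

Lemma psi_re_ge (theta : R) : sigma ^+ 2 * theta ^+ 2 / 2 <= psi_re theta.
Proof. by rewrite /psi_re lerDl; apply: Rintegral_ge0 => z _; exact: versine_ge0. Qed.

Lemma measurable_increment (t : R) : 0 <= t -> measurable_fun setT (fun w => X t w - X 0 w).
Proof. by move=> t0; apply: measurable_funB; exact: mX. Qed.

Lemma measurable_cos_increment (t theta : R) : 0 <= t ->
  measurable_fun setT (fun w => cos (theta * (X t w - X 0 w))).
Proof.
by move=> t0; apply: (measurableT_comp (measurable_mul_cos theta)); exact: measurable_increment.
Qed.

Lemma integrable_bounded_rv (g : T -> R) (C : R) : measurable_fun setT g ->
  (forall w, `|g w| <= C) -> P.-integrable setT (EFin \o g).
Proof.
move=> mg gC; apply: measurable_bounded_integrable => //.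
  exact: (le_lt_trans (probability_le1 P measurableT) (ltry 1)).
exists C; split; first exact: num_real.
by move=> x Cx w _; rewrite /= (le_trans (gC _))// ltW.
Qed.

(** The cosine is at least 1/2 on the event, where its argument is at most 1 in absolute value, and
    at least -1 elsewhere. The expectation is thus at least [3/2 * p - 1] for an event of
    probability [p], and [p >= 3/4] gives 1/8; any threshold above 2/3 would give a positive
    bound. *)
Lemma expectation_cos_ge (t theta c : R) : 0 <= t -> 0 <= theta -> theta * c <= 1 ->
  ((3 / 4)%:E <= P [set w | (`|X t w - X 0 w| <= c)%R])%E ->
  1 / 8 <= \int[P]_w cos (theta * (X t w - X 0 w)).
Proof.
move=> t0 th0 thc; set G := [set w | _] => PG.
have mG : measurable G.
  rewrite (_ : G = (fun w => X t w - X 0 w) @^-1` `[(- c), c]%classic); last first.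
    by apply/seteqP; split=> w; rewrite /G/= in_itv/= ler_norml.
  by rewrite -[X in measurable X]setTI; apply: measurable_increment.
have Gfin : P G \is a fin_num by exact: fin_num_measure.
have i1 : P.-integrable setT (EFin \o (\1_G : T -> R)).
  apply: (@integrable_bounded_rv _ 1); first exact: measurable_indic.
  by move=> w; rewrite indicE; case: (w \in G); rewrite /= ?normr1 ?normr0.
have i2 : P.-integrable setT (EFin \o (fun w =>
  3 / 2 * \1_G w : R)) by exact: (integrableZl _ _ i1).
have i3 : P.-integrable setT (EFin \o (fun w : T => 1 : R)).
  by apply: (@integrable_bounded_rv _ 1) => // w; rewrite normr1.
apply: (@le_trans _ _ (\int[P]_w (3 / 2 * \1_G w - 1))).
  rewrite RintegralB// RintegralZl// Rintegral_cst// (_ : fine (P setT) = 1) ?mulr1;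
    last by rewrite probability_setT.
  rewrite /Rintegral integral_indic// setIT.
  by move: PG; rewrite -(fineK Gfin) lee_fin; lra.
apply: le_Rintegral => //.
- exact: (integrableB _ i2 i3).
- apply: (@integrable_bounded_rv _ 1); first exact: measurable_cos_increment.
  by move=> w; exact: cos_max.
move=> w _; rewrite indicE; have [|_] := boolP (w \in G); last first.
  by have := cos_geN1 (theta * (X t w - X 0 w)); rewrite mulr0; lra.
rewrite inE/= /G/= => Gw; have := cos_ge_sqr (theta * (X t w - X 0 w)).
suff : (theta * (X t w - X 0 w)) ^+ 2 <= 1 by rewrite mulr1; lra.
rewrite -(real_normK (num_real _)) expr_le1//.
by rewrite normrM (ger0_norm th0) (le_trans _ thc)// ler_wpM2l.
Qed.

Lemma small_increment_gauss (alpha : R) : 0 < alpha -> 0 < sigma ->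
  exists2 r0 : R, 0 < r0 & forall r : R, 0 < r -> r < r0 ->
    (P [set w | (`|X r w - X 0 w| <= alpha * r)%R] <= (3 / 4)%:E)%E.
Proof.
(* At frequency [1 / (alpha r)] the Gaussian part of [r Re Psi] is [sigma^2 / (2 alpha^2 r)], which
   exceeds 8 for [r] below this bound; then [exp u >= 1 + u] puts the expectation under 1/8. *)
move=> a0 s0; exists (sigma ^+ 2 / (16 * alpha ^+ 2)).
  by rewrite divr_gt0 ?exprn_gt0// mulr_gt0 ?exprn_gt0.
move=> r r0 rr0; rewrite leNgt; apply/negP => /ltW PG.
have ar : 0 < alpha * r by rewrite mulr_gt0.
have th : 0 <= (alpha * r)^-1 by rewrite invr_ge0 ltW.
have := expectation_cos_ge (ltW r0) th _ PG; rewrite mulVf ?gt_eqF// => /(_ (lexx _)).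
rewrite expectation_cos ?(ltW r0)//; apply/negP; rewrite -ltNge.
apply: (@le_lt_trans _ _ (expR (- (r * psi_re (alpha * r)^-1)))).
  by rewrite ler_piMr ?expR_ge0// cos_le1.
have h8 : 8 <= r * psi_re (alpha * r)^-1.
  apply: (@le_trans _ _ (r * (sigma ^+ 2 * (alpha * r)^-1 ^+ 2 / 2))).
    have -> : r * (sigma ^+ 2 * (alpha * r)^-1 ^+ 2 / 2) = sigma ^+ 2 / (2 * alpha ^+ 2) / r.
      by field; rewrite !gt_eqF.
    move: rr0; rewrite ltr_pdivlMr; last by rewrite mulr_gt0 ?exprn_gt0.
    rewrite ler_pdivlMr// ler_pdivlMr; last by rewrite mulr_gt0 ?exprn_gt0.
    by move=> /ltW; lra.
  by rewrite ler_wpM2l ?psi_re_ge// ltW.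
rewrite expRN -[X in _ < X]invrK ltf_pV2 ?posrE ?expR_gt0 ?invr_gt0 ?divr_gt0//.
by have := expR_ge1Dx (r * psi_re (alpha * r)^-1); lra.
Qed.

Lemma psi_im0 : psi_im 0 = 0.
Proof.
rewrite /psi_im mulr0 oppr0 add0r (@eq_Rintegral _ _ _ _ _ (cst 0)) ?Rintegral_cst ?mul0r//.
by move=> z _; rewrite /sin_defect !mul0r sin0 subr0.
Qed.

Lemma small_increment_jumps (alpha eps : R) : 0 < alpha -> eps = 1 \/ eps = -1 ->
  (Pi [set z | (eps * z < 0)%R] < +oo)%E ->
  (\int[Pi]_z (Num.min 1 `|z|)%:E = +oo)%E ->
  exists2 r0 : R, 0 < r0 & forall r : R, 0 < r -> r < r0 ->
    (P [set w | (`|X r w - X 0 w| <= alpha * r)%R] <= (3 / 4)%:E)%E.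
Proof.
move=> a0 e1 of1 iv; have k0 : 0 < alpha^-1 by rewrite invr_gt0.
(* The extra [|gamma / alpha|] pays for the linear part of [Im Psi], which at frequency
   [1 / (alpha r)] and time [r] equals [gamma / alpha] up to sign. *)
have [r0 r00 H] := sin_defect_diverges lPi e1 of1 iv (pi + `|gamma * alpha^-1|) k0.
exists r0 => // r rgt0 rr0; rewrite leNgt; apply/negP => /ltW PG.
have ar : 0 < alpha * r by rewrite mulr_gt0.
set th := (alpha * r)^-1; have th0 : 0 <= th by rewrite invr_ge0 ltW.
have thE : alpha^-1 / r = th by rewrite /th invfM.
have big : pi <= `|r * psi_im th|.
  have := H r rgt0 rr0; rewrite thE /psi_im mulrDr.
  have -> : r * - (gamma * th) = - (gamma * alpha^-1).
    by rewrite /th; field; rewrite !gt_eqF.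
  move: (r * _) (gamma / alpha) => u v; have := ler_normD (- v + u) v.
  by rewrite addrAC addNr add0r; lra.
have cont : {within `[0, th], continuous (fun x => r * psi_im x)}.
  apply: continuous_subspaceT => x; apply: cvgMr; apply: cvgD;
    last exact: continuous_int_sin_defect.
  by apply: cvgN; apply: cvgMr; exact: cvg_id.
have [v vpi hv] : exists2 v : R, cos v = -1 &
    Num.min (r * psi_im 0) (r * psi_im th) <= v <= Num.max (r * psi_im 0) (r * psi_im th).
  rewrite psi_im0 mulr0; have pi0 := pi_ge0 R; move: big; rewrite ler_normr => /orP[h|h].
    by exists pi; rewrite ?cospi// ge_min le_max pi0/= h orbT.
  exists (- pi); rewrite ?cosN ?cospi// ge_min le_max; apply/andP; split; apply/orP;
    [right|left]; lra.
have [x] := IVT th0 cont hv; rewrite in_itv/= => /andP[x0 xth] rx.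
have := expectation_cos_ge (ltW rgt0) x0 _ PG => /(_ _).
have xar : x * (alpha * r) <= 1.
  by move: xth; rewrite /th -[X in _ <= X]mul1r ler_pdivlMr.
(* With cosine -1 the expectation is nonpositive, whatever the size of [Re Psi]. *)
move=> /(_ xar); rewrite expectation_cos ?(ltW rgt0)// rx vpi.
by have := expR_ge0 (- (r * psi_re x)); lra.
Qed.

End small_increments.

Lemma ae_forall_nat d (T : measurableType d) (R : realType)
  (mu : {measure set T -> \bar R}) (Q : nat -> T -> Prop) :
  (forall n, {ae mu, forall x, Q n x}) -> {ae mu, forall x, forall n, Q n x}.
Proof.
move=> aeQ.
have [N [mN N0 sN]] : mu.-negligible (\bigcup_n ~` [set x | Q n x]).
  by apply: negligible_bigcup => n; exact: aeQ.
by exists N; split => // x /= /existsNP[n nQ]; apply: sN; exists n.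
Qed.

Lemma Rintegral_sum_nat d (T : measurableType d) (R : realType)
    (mu : {measure set T -> \bar R}) (F : nat -> T -> R) n :
  (forall k, mu.-integrable setT (EFin \o F k)) ->
  mu.-integrable setT (EFin \o (fun x => \sum_(0 <= k < n) F k x)) /\
  \int[mu]_x (\sum_(0 <= k < n) F k x) = \sum_(0 <= k < n) \int[mu]_x F k x.
Proof.
move=> iF; elim: n => [|n [ih1 ih2]].
  rewrite big_geq//; under eq_fun do rewrite big_geq//; split.
    exact: integrable0.
  by rewrite Rintegral_cst// mul0r.
rewrite big_nat_recr//= -ih2; split.
  under eq_fun do rewrite big_nat_recr//=.
  exact: (integrableD _ ih1 (iF n)).
by under eq_Rintegral do rewrite big_nat_recr//=; rewrite RintegralD.
Qed.

Section liminf_finite.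
Variables (d : measure_display) (T : measurableType d) (R : realType).
Variables (P : {measure set T -> \bar R}).

(** Fatou's lemma makes the liminf of [W] integrable, hence finite almost everywhere, and a finite
    liminf is a bound along infinitely many [n]. *)
Lemma ae_frequently_bounded (W : nat -> T -> R) (C : R) :
  (forall n, measurable_fun setT (W n)) -> (forall n w, 0 <= W n w) ->
  (forall n, (\int[P]_w (W n w)%:E <= C%:E)%E) ->
  {ae P, forall w, exists B : R, forall N : nat, exists2 n, (N <= n)%N & W n w <= B}.
Proof.
move=> mW W0 WC.
pose g w := limn_einf (fun n => (W n w)%:E).
have g0 w : (0 <= g w)%E.
  rewrite /g limn_einf_lim; apply: lime_ge; first exact: is_cvg_einfs.
  by apply: nearW => n; apply: le_ereal_inf_tmp => _ [m _ <-]; rewrite lee_fin.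
have mg : measurable_fun setT g.
  rewrite (_ : g = (fun w => - limn_esup (fun n => - (W n w)%:E))%E); last first.
    by apply/funext => w; rewrite limn_esupN oppeK.
  apply: measurableT_comp => //; apply: measurable_fun_limn_esup => n.
  by apply: measurableT_comp => //; exact/measurable_EFinP.
have ig : P.-integrable setT g.
  apply/integrableP; split => //.
  under eq_integral do rewrite gee0_abs//.
  apply: (@le_lt_trans _ _ C%:E); last exact: ltry.
  apply: (le_trans (fatou P measurableT _ _)).
  - by move=> n; exact/measurable_EFinP.
  - by move=> n w _; rewrite lee_fin.
  - rewrite limn_einf_lim; apply: lime_le; first exact: is_cvg_einfs.
    apply: nearW => n; apply: (@le_trans _ _ (\int[P]_w (W n w)%:E)%E) => //.
    by apply: ereal_inf_lbound; exists n => /=.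
apply: ae_imp (integrable_ae measurableT ig) => w /(_ I) gfin.
apply: contrapT => nB.
suff : g w = +oo%E by move=> gy; move: gfin; rewrite gy.
have cy : (fun n => (W n w)%:E) @ \oo --> +oo%E.
  apply/cvgeyPger => B _; apply: contrapT => nBB; apply: nB; exists B => N.
  apply: contrapT => nN; apply: nBB; exists N => // n /= Nn; rewrite lee_fin leNgt.
  by apply/negP => WB; apply: nN; exists n => //; exact: ltW.
by rewrite /g is_cvg_limn_einfE; [exact: cvg_lim|apply/cvg_ex; eexists; exact: cy].
Qed.

End liminf_finite.

Lemma ae_exists d (T : measurableType d) (R : realType) (P : probability T R)
  (Q : T -> Prop) : {ae P, forall w, Q w} -> exists w, Q w.
Proof.
move=> [N [mN N0 sN]]; apply: contrapT => nQ.
have NT : N = setT.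
  apply/seteqP; split => // w _; apply: sN => /= Qw.
  by apply: nQ; exists w.
by have := probability_setT P; rewrite -NT N0 => /esym/eqP; rewrite onee_eq0.
Qed.

(** * Bounded variation of the paths *)

Section finite_variation.
Variables (d : measure_display) (T : measurableType d) (R : realType).
Variables (P : probability T R) (X : R -> T -> R) (x gamma : R).
Variable (Pi : {measure set R -> \bar R}).
Hypothesis levyX : levy_process P x X.
Hypothesis triplet : levy_triplet P X gamma 0 Pi.
Hypothesis finite_variation : (\int[Pi]_z (Num.min 1 `|z|)%:E < +oo)%E.

Let mX : forall t : R, 0 <= t -> measurable_fun setT (X t).
Proof. by case: levyX. Qed.
Let lPi : levy_measure Pi. Proof. by case: triplet. Qed.
Let J : R := \int[Pi]_z Num.min 1 `|z|.
Let a := psi_re 0 Pi.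
Let c := psi_im gamma Pi.

Let integrable_min : Pi.-integrable setT (EFin \o (fun z : R => Num.min 1 `|z|)).
Proof.
apply/integrableP; split.
  by apply/measurable_EFinP; apply: measurable_minr => //; exact: normr_measurable.
rewrite (eq_integral (fun z : R => (Num.min 1 `|z|)%:E))// => z _.
by rewrite /= ger0_norm// le_min ler01 normr_ge0.
Qed.

Let J0 : 0 <= J.
Proof. by apply: Rintegral_ge0 => z _; rewrite le_min ler01 normr_ge0. Qed.

Let K := `|gamma| + 4 * J.

(** For [|z| < 1] both terms of the defect are at most [theta |z|]; for larger [|z|] it is at most
    1. The estimate is in [t >= 1] rather than in [theta] because this last bound is not
    proportional to [theta]. *)
Lemma psi_im_le (theta : R) (t : R) : 0 <= theta <= t -> 1 <= t -> `|c theta| <= K * t.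
Proof.
move=> /andP[th0 tht] t1; rewrite /c /psi_im.
have iS := integrable_sin_defect lPi theta.
have iM : Pi.-integrable setT (EFin \o (fun z : R => 4 * t * Num.min 1 `|z|)).
  exact: (integrableZl _ _ integrable_min).
have : `|\int[Pi]_z sin_defect theta z| <= 4 * t * J.
  apply: (le_trans (le_normr_Rintegral _ _)) => //; rewrite -RintegralZl//.
  apply: le_Rintegral => //; first exact: (integrable_norm iS).
  move=> z _; rewrite /sin_defect indic_lt1; have [z1|z1] := ltP `|z| 1.
    rewrite mulr1; apply: (le_trans (ler_normB _ _)).
    apply: (@le_trans _ _ (`|theta * z| + `|theta * z|)).
      by rewrite lerD2l ler_norm_sin.
    rewrite normrM ger0_norm//; have := normr_ge0 z; nra.
  rewrite mulr0 sub0r normrN mulr1; have := sin_max (theta * z); lra.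
have := ler_normD (- (gamma * theta)) (\int[Pi]_z sin_defect theta z).
rewrite normrN normrM (ger0_norm th0) /K => h1 h2.
by have := normr_ge0 gamma; nra.
Qed.

(** With [E = exp(- h a)] and [C = cos(h c)], write [1 - E C = (1 - E) + E (1 - C)]. *)
Lemma expectation_versine_le (h theta : R) : 0 <= h ->
  \int[P]_w (1 - cos (theta * (X h w - X 0 w))) <= h * a theta + (h * c theta) ^+ 2 / 2.
Proof.
move=> h0; rewrite RintegralB//; first last.
- apply: (@integrable_bounded_rv _ _ _ _ _ 1); first exact: measurable_cos_increment.
  by move=> w; exact: cos_max.
- by apply: (@integrable_bounded_rv _ _ _ _ _ 1) => // w; rewrite normr1.
rewrite Rintegral_cst// (_ : fine (P setT) = 1) ?mulr1; last by rewrite probability_setT.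
rewrite (expectation_cos triplet _ h0) -/a -/c.
have a0 : 0 <= a theta.
  by apply: le_trans (psi_re_ge _ _ _); rewrite expr0n/= mul0r mul0r.
have ha : 0 <= h * a theta by rewrite mulr_ge0.
have := expR_ge1Dx (- (h * a theta)).
have : expR (- (h * a theta)) <= 1 by rewrite expR_le1 oppr_le0.
have := cos_ge_sqr (h * c theta); have := cos_le1 (h * c theta).
have := expR_ge0 (- (h * a theta)).
move: (expR _) (cos _) => E C; have := sqr_ge0 (h * c theta); nra.
Qed.

Lemma versine_stationary (s h theta : R) : 0 <= s -> 0 <= h ->
  (\int[P]_w (1 - cos (theta * (X (s + h)%R w - X s w)))%:E =
   \int[P]_w (1 - cos (theta * (X h w - X 0%R w)))%:E)%E.
Proof.
move=> s0 h0.
have m1 : measurable_fun setT (X (s + h) \- X s).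
  by apply: measurable_funB; apply: mX => //; rewrite addr_ge0.
have m2 : measurable_fun setT (X h \- X 0) by apply: measurable_funB; apply: mX.
have mg : measurable_fun setT (fun y : R => (1 - cos (theta * y))%:E).
  by apply/measurable_EFinP; apply: measurable_versine.
have g0 : {in setT, forall y : R, (0 <= (1 - cos (theta * y))%:E)%E}.
  by move=> y _; rewrite lee_fin subr_ge0 cos_le1.
have := ge0_integral_pushforward m1 P measurableT mg g0.
have := ge0_integral_pushforward m2 P measurableT mg g0.
rewrite !preimage_setT /comp/= => <- <-.
apply: eq_measure_integral => B mB _; rewrite /pushforward.
exact: (levy_stationary levyX).
Qed.

(** The first term collects [Re Psi] over all scales, the second the quadratic contribution of
    [Im Psi]. *)
Let C := 12 * J + K ^+ 2 / 2.

(** Exchanging sum and integral turns the left side into the integral of [osc n (z / M)], which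
    [osc_le] bounds by that of [12 min(1, |z|)], uniformly in [n] and [M]. *)
Lemma sum_psi_re_le (M : R) n : 1 <= M ->
  \sum_(0 <= k < n) 2 ^- k * a (2 ^+ k / M) <= 12 * J.
Proof.
move=> M1; have M0 : 0 < M by exact: lt_le_trans M1.
have iF k : Pi.-integrable setT (EFin \o (fun z => 2 ^- k * versine (2 ^+ k / M) z)).
  by apply: (integrableZl _ _ (integrable_versine lPi _)).
have [i1 e1] := Rintegral_sum_nat n iF.
rewrite (_ : \sum_(0 <= k < n) _ = \int[Pi]_z (\sum_(0 <= k < n) 2 ^- k * versine (2 ^+ k / M)
  z)); last first.
  rewrite e1; apply: eq_bigr => k _; rewrite /a /psi_re expr0n/= mul0r mul0r add0r.
  by rewrite RintegralZl//; exact: integrable_versine.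
rewrite -RintegralZl//; apply: le_Rintegral => //.
  exact: (integrableZl _ _ integrable_min).
move=> z _; have := osc_le n (z / M).
have -> : \sum_(0 <= k < n) 2 ^- k * versine (2 ^+ k / M) z = osc n (z / M).
  by apply: eq_bigr => k _; rewrite /versine mulrAC mulrA.
move=> /le_trans; apply; rewrite ler_pM2l//.
have zM : `|z / M| <= `|z|.
  by rewrite normrM normfV (gtr0_norm M0) ler_pdivrMr// ler_peMr.
have d0 : 0 < 1 + `|z / M| by rewrite ltr_pwDl.
rewrite ler_pdivrMr//; move: zM d0; move: `|z / M| (normr_ge0 (z / M)) => u u0 zM d0.
by have [h|h] := leP 1 `|z|; nra.
Qed.

(** The number of scales is tied to the mesh [h = 2^-n]: the terms [h^2 K^2 / 2 * 2^k] coming from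
    [Im Psi] then sum to at most [h K^2 / 2]. A bound linear in [h] is what summation over the [2^n]
    increments of [0, 1] can afford. *)
Lemma expectation_osc_le (M s : R) n : 1 <= M -> 0 <= s ->
  P.-integrable setT (EFin \o (fun w => osc n ((X (s + 2 ^- n) w - X s w) / M))) /\
  \int[P]_w osc n ((X (s + 2 ^- n) w - X s w) / M) <= 2 ^- n * C.
Proof.
move=> M1 s0; have M0 : 0 < M by exact: lt_le_trans M1.
set h : R := 2 ^- n; have h0 : 0 <= h by rewrite invr_ge0 exprn_ge0.
pose V k w : R := 1 - cos (2 ^+ k / M * (X (s + h) w - X s w)).
have mV k : measurable_fun setT (V k).
  apply: (measurableT_comp (measurable_versine (2 ^+ k / M))).
  by apply: measurable_funB; apply: mX => //; rewrite addr_ge0.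
have iV k : P.-integrable setT (EFin \o V k).
  apply: (@integrable_bounded_rv _ _ _ _ _ 2) => // w.
  rewrite ger0_norm /V ?subr_ge0 ?cos_le1//.
  by have := cos_geN1 (2 ^+ k / M * (X (s + h) w - X s w)); lra.
have iF k : P.-integrable setT (EFin \o (fun w => 2 ^- k * V k w)).
  exact: (integrableZl _ _ (iV k)).
have [i1 e1] := Rintegral_sum_nat n iF.
have E w : osc n ((X (s + h) w - X s w) / M) = \sum_(0 <= k < n) 2 ^- k * V k w.
  by apply: eq_bigr => k _; rewrite /V mulrA mulrAC.
under eq_fun do rewrite E; split => //.
rewrite e1.
apply: (@le_trans _ _ (\sum_(0 <= k < n)
   (h * (2 ^- k * a (2 ^+ k / M)) + h ^+ 2 * K ^+ 2 / 2 * 2 ^+ k))).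
  apply: ler_sum => k _; rewrite RintegralZl//.
  have -> : \int[P]_w V k w = \int[P]_w (1 - cos (2 ^+ k / M * (X h w - X 0 w))).
    by rewrite /Rintegral /V versine_stationary.
  have k0 : 0 < 2 ^- k :> R by rewrite invr_gt0 exprn_gt0.
  have p0 : 0 < 2 ^+ k :> R by rewrite exprn_gt0.
  have := expectation_versine_le (2 ^+ k / M) h0.
  move=> /(ler_wpM2l (ltW k0)) hV; apply: (le_trans hV).
  rewrite mulrDr mulrCA lerD2l.
  have : `|c (2 ^+ k / M)| <= K * 2 ^+ k.
    apply: psi_im_le; last by rewrite exprn_ege1// ler1n.
    by rewrite divr_ge0 ?(ltW p0) ?(ltW M0)//= ler_pdivrMr// ler_peMr// ltW.
  move=> cK; have {cK} : c (2 ^+ k / M) ^+ 2 <= (K * 2 ^+ k) ^+ 2.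
    rewrite -(real_normK (num_real (c _))) lerXn2r ?nnegrE//.
    by apply: le_trans cK.
  move=> cK; rewrite [X in X <= _](_ : _ = h ^+ 2 / 2 * 2 ^- k * c (2 ^+ k / M) ^+ 2);
    last by ring.
  rewrite [X in _ <= X](_ : _ = h ^+ 2 / 2 * 2 ^- k * (K * 2 ^+ k) ^+ 2); last by field;
    rewrite gt_eqF.
  by rewrite ler_wpM2l// mulr_ge0 ?(ltW k0)// divr_ge0// exprn_ge0.
rewrite big_split/= -mulr_sumr -mulr_sumr /C mulrDr lerD//.
  by rewrite ler_wpM2l// sum_psi_re_le.
have : \sum_(0 <= k < n) 2 ^+ k <= 2 ^+ n :> R.
  elim: (n) => [|m ih]; first by rewrite big_geq// expr0.
  by rewrite big_nat_recr//= exprS; lra.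
have hn : h * 2 ^+ n = 1 by rewrite mulVf// gt_eqF// exprn_gt0.
have : 0 <= h * (h * K ^+ 2 / 2) by rewrite mulr_ge0// divr_ge0// mulr_ge0// sqr_ge0.
move=> q0 /(ler_wpM2l q0); rewrite [h * (h * _ / 2) * 2 ^+ n](_ : _ = h * (K ^+ 2 / 2) * (h * 2
  ^+ n)); last by ring.
by rewrite hn mulr1; apply: le_trans; rewrite le_eqVlt; apply/orP; left; apply/eqP; ring.
Qed.

(** Dividing by [M] brings the increments into [-1, 1], where [osc_ge] applies. The bound of a path
    is random, so the almost sure statement below covers all positive integers [M] at once. *)
Definition osc_variation (M : R) n w : R :=
  \sum_(0 <= j < 2 ^ n) osc n ((X (dyad R n j.+1) w - X (dyad R n j) w) / M).

Lemma osc_variation_bounded : {ae P, forall w, forall m : nat,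
  exists B : R, forall N : nat, exists2 n, (N <= n)%N & osc_variation m.+1%:R n w <= B}.
Proof.
apply: ae_forall_nat => m; set M : R := m.+1%:R.
have M1 : 1 <= M by rewrite ler1n.
have iF n j : P.-integrable setT (EFin \o (fun w =>
  osc n ((X (dyad R n j.+1) w - X (dyad R n j) w) / M))).
  by have [] := expectation_osc_le n M1 (dyad_ge0 R n j); rewrite -dyadS.
have iW n := Rintegral_sum_nat (2 ^ n) (iF n).
apply: (@ae_frequently_bounded _ _ _ _ _ C).
- by move=> n; apply/measurable_EFinP; have [/integrableP[]] := iW n.
- move=> n w; apply: sumr_ge0 => j _; apply: sumr_ge0 => k _.
  by rewrite mulr_ge0 ?invr_ge0 ?exprn_ge0// subr_ge0 cos_le1.
- move=> n; have [i1 e1] := iW n.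
  rewrite -(fineK (integrable_fin_num _ i1))// lee_fin.
  rewrite -[leLHS]/(\int[P]_w osc_variation M n w) e1.
  apply: (@le_trans _ _ (\sum_(0 <= j < 2 ^ n) 2 ^- n * C)).
    apply: ler_sum => j _; have [_] := expectation_osc_le n M1 (dyad_ge0 R n j).
    by rewrite -dyadS.
  rewrite sumr_const_nat subn0 -[leLHS]mulr_natl natrX mulrA mulfV ?mul1r//.
Qed.

(** The error [2^-n] of [osc_ge] occurs once for each of the [2^n] increments, whence the summand
    1. *)
Lemma dyadic_variation_le (f : R -> R) (M : R) n : 0 < M ->
  (forall k, (k <= 2 ^ n)%N -> `|f (dyad R n k)| <= M / 2) ->
  (1 - cos (1 / 2)) * dyadic_variation f n <=
  M * (\sum_(0 <= j < 2 ^ n) osc n ((f (dyad R n j.+1) - f (dyad R n j)) / M) + 1).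
Proof.
move=> M0 fM; rewrite /dyadic_variation.
have e1 : 1 = \sum_(0 <= j < 2 ^ n) 2 ^- n :> R.
  by rewrite sumr_const_nat subn0 -[RHS]mulr_natl natrX mulfV.
rewrite [X in M * (_ + X)]e1 -big_split/= !mulr_sumr !big_nat; apply: ler_sum => j /= jn.
set y := f _ - f _.
have yM : `|y / M| <= 1.
  rewrite normrM normfV (gtr0_norm M0) ler_pdivrMr// mul1r.
  rewrite (le_trans (ler_normB _ _))//.
  by have := fM _ jn; have := fM _ (ltnW jn); lra.
have := osc_ge n yM; rewrite normrM normfV (gtr0_norm M0) => h.
rewrite -ler_pdivrMl//; move: h; set u := 1 - _; rewrite mulrC; lra.
Qed.

(** One path in the intersection of the almost sure events is enough: it has bounded variation on
    [0, 1/2]. *)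
Lemma not_unbounded_variation_paths : ~ unbounded_variation_paths P X.
Proof.
move=> uv.
have [w [[buv cw] ow]] := ae_exists (ae_and (ae_and uv (levy_cadlag levyX))
  osc_variation_bounded).
apply: (buv (1 / 2)); first by rewrite divr_gt0.
have [M0 hM0] := cadlag_bounded 1 cw.
pose m := Num.truncn (2 * M0).
have mM : 2 * M0 < m.+1%:R by exact: truncnS_gt.
have [B hB] := ow m.
set c0 : R := 1 - cos (1 / 2).
have c00 : 0 < c0.
  rewrite subr_gt0 -[ltRHS]cos0 ltr_cos ?in_itv/= ?lexx ?pi_ge0//.
  by have := pi_ge2 R; lra.
apply: (@bounded_variation_dyadic _ _ (m.+1%:R * (B + 1) / c0)); first by case: cw.
move=> k; have [n kn hn] := hB k; exists n => //.
rewrite ler_pdivlMr// mulrC; apply: (le_trans (@dyadic_variation_le _ m.+1%:R n _ _)) => //.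
  move=> l ln; apply: (@le_trans _ _ M0); last by rewrite ler_pdivlMr// mulrC ltW.
  apply: hM0; rewrite dyad_ge0/= ler_pdivrMr ?exprn_gt0// mul1r -natrX ler_nat.
  exact: ln.
by rewrite ler_wpM2l// lerD2r.
Qed.

End finite_variation.

Lemma le_lebesgue (R : realType) (A B : set R) : measurable A -> measurable B ->
  A `<=` B -> (@lebesgue_measure R A <= @lebesgue_measure R B)%E.
Proof.
move=> mA mB AB; apply: le_measure => //; first by apply/mem_set; exact: mA.
by apply/mem_set; exact: mB.
Qed.

Lemma lebesgueU_le (R : realType) (A B : set R) : measurable A -> measurable B ->
  (@lebesgue_measure R (A `|` B) <= @lebesgue_measure R A + @lebesgue_measure R B)%E.
Proof. by move=> mA mB; apply: measureU2; [exact: mA|exact: mB]. Qed.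

Section right_density.
Variable R : realType.
Local Notation mu := (@lebesgue_measure R).

(** The left half of a ball of radius [h] has measure [h], so the right-hand ratio is at least twice
    the two-sided ratio minus 1. *)
Lemma right_lebesgue_density (A : set R) : measurable A ->
  {ae mu, forall s, A s ->
    (mu (A `&` `]s, (s + 2 ^- n)%R[) * (2 ^+ n)%:E)%E @[n --> \oo] --> 1%E}.
Proof.
move=> mA; apply: ae_imp (lebesgue_density mA) => s + As.
rewrite indicE mem_set//= => dens.
have h0 n : 0 < 2 ^- n :> R by rewrite invr_gt0 exprn_gt0.
have c1 : (mu (A `&` ball s (2 ^- n)) * (mu (ball s (2 ^- n)))^-1)%E @[n --> \oo] --> 1%:E.
  have cr : (2 ^- n : R) @[n --> \oo] --> 0^'+.
    move=> U U0; have := @pow2_inv_cvg0 R _ U0.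
    by move=> [N _ HN]; exists N => // n Nn; exact: HN n Nn (h0 n).
  exact: (cvg_comp _ _ cr dens).
set q := fun n => fine (mu (A `&` `]s, (s + 2 ^- n)%R[)).
set a := fun n => fine (mu (A `&` ball s (2 ^- n))).
have mI n : measurable (A `&` `]s, (s + 2 ^- n)%R[%classic) by exact: measurableI.
have mB n : measurable (A `&` ball s (2 ^- n)).
  by apply: measurableI => //; exact: measurable_ball.
have qE n : (mu (A `&` `]s, (s + 2 ^- n)%R[) <= (2 ^- n)%:E)%E.
  apply: (@le_trans _ _ (mu `]s, (s + 2 ^- n)%R[)); first exact: le_lebesgue.
  have := lebesgue_measure_itv `]s, (s + 2 ^- n)%R[; rewrite /= lte_fin ltrDl h0 => ->.
  by rewrite -EFinD addrAC subrr add0r.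
have qfin n : mu (A `&` `]s, (s + 2 ^- n)%R[) \is a fin_num.
  by rewrite ge0_fin_numE ?measure_ge0// (le_lt_trans (qE n))// ltry.
have ballE n : mu (ball s (2 ^- n)) = (2 ^- n *+ 2)%:E.
  by apply: lebesgue_measure_ball; exact: ltW.
have afin n : mu (A `&` ball s (2 ^- n)) \is a fin_num.
  rewrite ge0_fin_numE ?measure_ge0// (@le_lt_trans _ _ (mu (ball s (2 ^- n))))//.
    by apply: le_lebesgue => //; exact: measurable_ball.
  by rewrite ballE ltry.
have aq n : a n <= q n + 2 ^- n.
  rewrite -lee_fin EFinD !fineK//.
  have e1 : mu `](s - 2 ^- n)%R, s] = (2 ^- n)%:E.
    have := lebesgue_measure_itv `](s - 2 ^- n)%R, s]; rewrite /= lte_fin ltrBlDr ltrDl h0 => ->.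
    by rewrite -EFinB opprB addrC subrK.
  rewrite -e1; apply: le_trans (lebesgueU_le (mI n) (measurable_itv _)).
  apply: le_lebesgue => //; first exact: measurableU.
  move=> u [Au]; rewrite /ball/= ltr_norml => /andP[u1 u2].
  have [su|us] := ltP s u; [left; split => //|right] => /=; rewrite in_itv/=; lra.
have c2 : a n / (2 ^- n *+ 2) @[n --> \oo] --> (1 : R).
  have /fine_cvgP[_] := c1; apply: cvg_trans; apply: near_eq_cvg; apply: nearW => n /=.
  rewrite ballE -(fineK (afin n)) inver gt_eqF ?mulrn_wgt0//.
rewrite (_ : (fun n => _) = (fun n => (q n * 2 ^+ n)%:E)); last first.
  by apply/funext => n; rewrite EFinM fineK.
apply: cvg_EFin; first by apply: nearW.
apply: (@squeeze_cvgr _ _ _ _ (fun n => 2 * (a n / (2 ^- n *+ 2)) - 1) (cst 1)).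
- apply: nearW => n /=; have hn : 2 ^- n * 2 ^+ n = 1 :> R by rewrite mulVf// gt_eqF// exprn_gt0.
  have p0 : 0 < 2 ^+ n :> R by rewrite exprn_gt0.
  have -> : a n / (2 ^- n *+ 2) = a n * 2 ^+ n / 2.
    by field; rewrite gt_eqF.
  have q1 : q n <= 2 ^- n by rewrite -lee_fin fineK.
  have := aq n; rewrite -(ler_pM2r p0) mulrDl hn => aq'.
  have := q1; rewrite -(ler_pM2r p0) hn => q1'; lra.
- have e1 : (1 : R) = 2 * 1 - 1 by lra.
  suff : 2 * (a n / (2 ^- n *+ 2)) - 1 @[n --> \oo] --> (2 * 1 - 1 : R) by rewrite -e1.
  by apply: cvgB; [apply: cvgMr|exact: cvg_cst].
- exact: cvg_cst.
Qed.

End right_density.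

(** * Lebesgue density *)

Section density_null.
Variables (d : measure_display) (T : measurableType d) (R : realType).
Variables (P : probability T R) (E : set (T * R)) (K r0 c : R).
Local Notation mu := (@lebesgue_measure R).
Hypotheses (mE : measurable E) (EK : forall p, E p -> 0 <= p.2 <= K).
Hypotheses (r00 : 0 < r0) (K0 : 0 <= K) (c0 : 0 <= c) (c1 : c < 1).
Hypothesis pair_bound : forall s u : R, s < u -> u < s + r0 ->
  (P (ysection E s `&` ysection E u) <= c%:E * P (ysection E s))%E.

Let L n (p : T * R) : \bar R := mu (xsection E p.1 `&` `]p.2, (p.2 + 2 ^- n)%R[).

Let measurable_L n : measurable_fun setT (L n).
Proof.
pose S : set ((T * R) * R) :=
  [set q | [/\ E (q.1.1, q.2), (q.1.2 < q.2)%R & (q.2 < q.1.2 + 2 ^- n)%R]].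
have -> : L n = mu \o xsection S.
  apply/funext => p /=; congr (mu _); apply/seteqP; split => u /=.
    rewrite in_itv/= => -[h1 /andP[h2 h3]]; rewrite /xsection/= inE; split => //.
    by move: h1; rewrite /xsection/= inE.
  rewrite /xsection/= inE => -[/= h1 h2 h3]; rewrite in_itv/= h2 h3; split => //.
  by rewrite inE.
apply: measurable_fun_xsection.
have m1 : measurable_fun setT (fun q : (T * R) * R => (q.1.1, q.2)).
  by apply: measurable_fun_pair => //; exact: measurableT_comp.
have mt (q : (T * R) * R -> bool) : measurable_fun setT q -> measurable [set x | q x].
  by move=> mq; rewrite -[X in measurable X]setTI; exact: (mq measurableT [set true]).
have -> : S = (fun q : (T * R) * R => (q.1.1, q.2)) @^-1` E `&`
    ([set q | (q.1.2 < q.2)%R] `&` [set q | (q.2 < q.1.2 + 2 ^- n)%R]).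
  by apply/seteqP; split=> q [] // h1 [].
apply: measurableI.
  by rewrite -[X in measurable X]setTI; exact: m1.
apply: measurableI; apply: mt; apply: measurable_fun_ltr => //.
- exact: measurableT_comp.
- by apply: measurable_funD => //; exact: measurableT_comp.
Qed.

(** On [E], the fraction of the window of length [2^-n] after [p.2] that the section of [E] fills;
    it tends to the indicator of [E] at density points. *)
Let M n (p : T * R) : \bar R := ((\1_E p)%:E * (L n p * (2 ^+ n)%:E))%E.

Let measurable_M n : measurable_fun setT (M n).
Proof.
apply: emeasurable_funM; first by apply/measurable_EFinP; exact: measurable_indic.
by apply: emeasurable_funM => //; exact: measurable_cst.
Qed.

Let M_ge0 n p : (0 <= M n p)%E.
Proof. by rewrite !mule_ge0// ?lee_fin// exprn_ge0. Qed.

Let M_le1 n p : (M n p <= (\1_E p)%:E)%E.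
Proof.
rewrite /M indicE; case: (p \in E); rewrite /= ?mul0e// mul1e.
have : (L n p <= (2 ^- n)%:E)%E.
  apply: (@le_trans _ _ (mu `]p.2, (p.2 + 2 ^- n)%R[)).
    apply: le_lebesgue => //; apply: measurableI => //; exact: measurable_xsection.
  rewrite (lebesgue_measure_itv `]p.2, (p.2 + 2 ^- n)%R[)/= lte_fin ltrDl invr_gt0 exprn_gt0//.
  by rewrite -EFinD addrAC subrr add0r.
move=> /(lee_wpmul2r _)-/(_ (2 ^+ n)%:E); rewrite lee_fin exprn_ge0// => /(_ isT) /le_trans;
  apply.
by rewrite -EFinM mulVf// gt_eqF// exprn_gt0.
Qed.

Let f (w : T) : \bar R := mu (xsection E w).

Let f_le w : (f w <= K%:E)%E.
Proof.
apply: (@le_trans _ _ (mu `[0, K])).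
  apply: le_lebesgue => //; first exact: measurable_xsection.
  by move=> s; rewrite /xsection/= inE => /EK/=; rewrite in_itv.
have := lebesgue_measure_itv `[0, K]; rewrite /= lte_fin => ->.
by case: ifP => _; rewrite ?sube0 ?lee_fin.
Qed.

Let mf : measurable_fun setT f.
Proof. exact: measurable_fun_xsection. Qed.

(** By Fubini at fixed [s], the left side is the average over [u] in the window of the probability
    that both [s] and [u] belong to the random section, and [pair_bound] applies to each [u]. *)
Let integral_section n s : 2 ^- n < r0 ->
  (\int[P]_w M n (w, s) <= c%:E * P (ysection E s))%E.
Proof.
move=> nr0.
pose S : set (T * R) := (ysection E s `*` `]s, (s + 2 ^- n)%R[) `&` E.
have mS : measurable S.
  by apply: measurableI => //; apply: measurableX => //; exact: measurable_ysection.
have ME w : M n (w, s) = ((2 ^+ n)%:E * mu (xsection S w))%E.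
  rewrite /M /L /= muleCA muleA muleC; congr (_ * _)%E.
  rewrite indicE; have [Ews|nE] := boolP ((w, s) \in E).
    rewrite mule1; congr (mu _); apply/seteqP; split => u; rewrite /xsection/= !inE.
      by move=> [h1 h2]; split => //; split => //=; rewrite /ysection/= inE; exact: set_mem.
    by move=> [[_ h2] h1]; split.
  rewrite mule0 (_ : xsection S w = set0) ?measure0//.
  apply/seteqP; split => u //; rewrite /xsection/= inE => -[[/= h _] _].
  by move: nE; move: h; rewrite /ysection/= => ->.
under eq_integral do rewrite ME.
rewrite ge0_integralZl//; last exact: measurable_fun_xsection.
have -> : (\int[P]_w mu (xsection S w) = \int[mu]_u P (ysection S u))%E.
  have := indic_fubini_tonelli P mu mS.
  by rewrite indic_fubini_tonelli_FE// indic_fubini_tonelli_GE.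
have bd u : (P (ysection S u) <= c%:E * P (ysection E s) * (\1_(`]s, (s + 2 ^- n)%R[%classic :
  set R) u)%:E)%E.
  rewrite indicE; have [|nu] := boolP (u \in _).
    rewrite inE/= in_itv/= mule1 => /andP[su us].
    apply: le_trans (pair_bound su _); last by rewrite (lt_trans us)// ltrD2l.
    apply: le_measure; first exact/mem_set/measurable_ysection.
    + by apply/mem_set; apply: measurableI; exact: measurable_ysection.
    + move=> w; rewrite /ysection/= !inE => -[[h1 h2] h3]; split => //.
      by move: h1; rewrite /ysection/= inE.
  rewrite mule0 (_ : ysection S u = set0) ?measure0//.
  apply/seteqP; split => w //; rewrite /ysection/= inE => -[[_ /= h] _].
  by move: nu; rewrite notin_setE => /(_ h).
have cP0 : (0 <= c%:E * P (ysection E s))%E by rewrite mule_ge0.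
apply: (@le_trans _ _ ((2 ^+ n)%:E * \int[mu]_u (c%:E * P (ysection E s) * (\1_(`]s, (s + 2 ^-
  n)%R[%classic : set R) u)%:E))%E).
  apply: lee_wpmul2l; first by rewrite lee_fin exprn_ge0.
  apply: ge0_le_integral => //.
  - exact: measurable_fun_ysection.
  - by apply: emeasurable_funM => //; apply/measurable_EFinP; exact: measurable_indic.
rewrite ge0_integralZl//; last first.
  by apply/measurable_EFinP; exact: measurable_indic.
rewrite integral_indic// setIT.
have := lebesgue_measure_itv `]s, (s + 2 ^- n)%R[;
  rewrite /= lte_fin ltrDl invr_gt0 exprn_gt0// => ->.
rewrite -EFinD addrAC subrr add0r muleCA -EFinM mulfV ?mule1//.
Qed.

Let integral_M n : 2 ^- n < r0 ->
  (\int[P]_w \int[mu]_s M n (w, s) <= c%:E * \int[P]_w f w)%E.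
Proof.
move=> nr0.
have -> : (\int[P]_w \int[mu]_s M n (w, s) = \int[mu]_s \int[P]_w M n (w, s))%E.
  exact: (@fubini_tonelli _ _ _ _ _ P mu _ (measurable_M n) (M_ge0 n)).
have -> : (\int[P]_w f w = \int[mu]_u P (ysection E u))%E.
  have := indic_fubini_tonelli P mu mE.
  by rewrite indic_fubini_tonelli_FE// indic_fubini_tonelli_GE.
rewrite -ge0_integralZl//; last by apply: measurable_fun_ysection.
apply: ge0_le_integral => //.
- by move=> s _; apply: integral_ge0.
- exact: (@measurable_fun_fubini_tonelli_G _ _ _ _ _ P _ (measurable_M n) (M_ge0 n)).
- by apply: emeasurable_funM => //; exact: measurable_fun_ysection.
- by move=> s _; exact: integral_section.
Qed.

Let measurable_section_indic w : measurable_fun setT (fun s : R => \1_E (w, s) : R).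
Proof.
rewrite (_ : (fun _ => _) = \1_(xsection E w)).
  by apply: measurable_indic; exact: measurable_xsection.
by apply/funext => s; rewrite !indicE mem_xsection.
Qed.

Let section_integral w : f w = (\int[mu]_s (\1_E (w, s))%:E)%E.
Proof. exact: (esym (congr1 (fun g => g w) (@indic_fubini_tonelli_FE _ _ _ _ _ mu _ mE))). Qed.

Let cvg_section w : (\int[mu]_s M n (w, s))%E @[n --> \oo] --> f w.
Proof.
have mEw : measurable (xsection E w) by exact: measurable_xsection.
have m1 n : measurable_fun setT (fun s : R => M n (w, s)).
  exact: (measurableT_comp (measurable_M n) (pair1_measurable w)).
have iK : mu.-integrable setT (EFin \o (\1_(`[0, K]%classic : set R) : R -> R)).
  exact: integrable_indic_itv.
rewrite section_integral.
have [|||||_ _] := @dominated_convergence _ _ _ mu setT measurableT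
  (fun n s => M n (w, s)) (fun s => (\1_E (w, s))%:E) (EFin \o \1_(`[0, K]%classic : set R)).
- by [].
- by apply/measurable_EFinP; exact: measurable_section_indic.
- apply: ae_imp (right_lebesgue_density mEw) => s dens _; rewrite /M.
  have [Ews|nE] := boolP ((w, s) \in E); last first.
    by rewrite indicE (negbTE nE); apply: cvg_near_cst; apply: nearW => n; rewrite mul0e.
  have := dens; rewrite /xsection/= => /(_ Ews); rewrite indicE Ews.
  by under [in X in _ -> X]eq_fun do rewrite mul1e.
- exact: iK.
- apply: aeW => s n _; rewrite gee0_abs//; apply: (le_trans (M_le1 _ _)).
  rewrite /= !indicE lee_fin; have [|_] := boolP ((w, s) \in E); last by [].
  by rewrite inE => /EK/= sK; rewrite mem_set//= in_itv.
by [].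
Qed.

(** The double integral of [M n] tends to the mass of [E] by density, yet is at most [c] times this
    mass for large [n]. The mass is finite because [E] lies over [0, K], so [c < 1] forces it to be
    0. *)
Lemma density_null : {ae P, forall w, mu (xsection E w) = 0%E}.
Proof.
have mF n : measurable_fun setT (fun w => \int[mu]_s M n (w, s))%E.
  exact: (@measurable_fun_fubini_tonelli_F _ _ _ _ _ mu _ (measurable_M n) (M_ge0 n)).
have f0 w : (0 <= f w)%E by [].
have iK : P.-integrable setT (fun _ : T => K%:E).
  apply: (@integrable_bounded_rv _ _ _ P (fun=> K) K) => // w.
  by rewrite ger0_norm.
have [|||||If _ cv] := @dominated_convergence _ _ _ P setT measurableT
  (fun n w => \int[mu]_s M n (w, s))%E f (fun=> K%:E).
- by [].
- exact: mf.
- by apply: aeW => w _; exact: cvg_section.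
- exact: iK.
- apply: aeW => w n _; rewrite gee0_abs; last by apply: integral_ge0.
  apply: le_trans (f_le w).
  rewrite section_integral.
  apply: ge0_le_integral => //.
  + exact: (measurableT_comp (measurable_M n) (pair1_measurable w)).
  + by apply/measurable_EFinP; exact: measurable_section_indic.
have le1 : (\int[P]_w f w <= c%:E * \int[P]_w f w)%E.
  rewrite -[leLHS](cvg_lim _ cv)//; apply: lime_le; first by apply/cvg_ex; eexists; exact: cv.
  have [N _ HN] : \forall n \near \oo, 2 ^- n < r0 by apply: (cvgr_lt 0) => //;
    exact: pow2_inv_cvg0.
  by exists N => // n Nn; apply: integral_M; exact: HN.
have J0 : (\int[P]_w f w = 0)%E.
  have := integrable_fin_num measurableT If => Jfin.
  have Jge : (0 <= \int[P]_w f w)%E by apply: integral_ge0.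
  move: le1 Jge; rewrite -(fineK Jfin) -EFinM !lee_fin => h1 h2; congr EFin.
  apply/eqP; rewrite eq_le h2 andbT leNgt; apply/negP => x0.
  by move: h1; rewrite leNgt gtr_pMl ?c1.
have : (\int[P]_w `|f w| = 0)%E.
  by under eq_integral do rewrite gee0_abs//.
by move/(ae_eq_integral_abs P measurableT mf); apply: ae_imp => w /(_ I).
Qed.

End density_null.

(** * Measurability of the scheme *)

Section measurable_scheme.
Variables (d : measure_display) (T : measurableType d) (R : realType).
Variables (X : R -> T -> R) (alpha b : R).

Lemma measurable_rate_rv n k : measurable_fun setT (X (dyad R n k)) ->
  measurable_fun setT (fun w => euler alpha b (X ^~ w) n k) ->
  measurable_fun setT (fun w => rate alpha b (X ^~ w) n k).
Proof.
move=> mX me; apply: (measurable_above_comp b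
  (y := fun w => X (dyad R n k) w - alpha * euler alpha b (X ^~ w) n k)).
by apply: measurable_funB => //; apply: measurable_funM => //; exact: measurable_cst.
Qed.

Lemma measurable_euler_rv n k :
  (forall j, (j < k)%N -> measurable_fun setT (X (dyad R n j))) ->
  measurable_fun setT (fun w => euler alpha b (X ^~ w) n k).
Proof.
elim: k => [|k ih] mX /=; first exact: measurable_cst.
have me : measurable_fun setT (fun w => euler alpha b (X ^~ w) n k).
  by apply: ih => j jk; apply: mX; exact: ltnW.
apply: measurable_funD => //; apply: measurable_funM; first exact: measurable_cst.
by apply: measurable_rate_rv => //; exact: mX.
Qed.

(** The scheme up to time [s] reads the path at grid times at most [s]. Since the sigma-algebra of
    [T] is arbitrary, taking the one generated by the past of [X] turns this into adaptedness. *)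
Lemma measurable_limit_drift_rv (s : R) : 0 <= s ->
  (forall r : R, 0 <= r <= s -> measurable_fun setT (X r)) ->
  measurable_fun setT (fun w => limit_drift alpha b (X ^~ w) s).
Proof.
move=> s0 mX; apply: measurable_fun_limn_sup.
- move=> w _; exists `|s| => _ [n _ <-].
  exact: le_trans (ler_norm _) (drift_bound _ _ _ _ _).
- move=> w _; exists (- `|s|) => _ [n _ <-].
  by have := drift_bound alpha b (X ^~ w) n s; rewrite ler_norml => /andP[].
move=> n; have /andP[cs _] := cell_itv n s0.
have mXj j : (j <= cell n s)%N -> measurable_fun setT (X (dyad R n j)).
  move=> js; apply: mX; rewrite dyad_ge0/=; apply: le_trans cs.
  by rewrite dyad_le.
have me : measurable_fun setT (fun w => euler alpha b (X ^~ w) n (cell n s)).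
  by apply: measurable_euler_rv => j /ltnW/mXj.
apply: measurable_funD => //; apply: measurable_funM; first exact: measurable_cst.
by apply: measurable_rate_rv => //; exact: mXj.
Qed.

Hypothesis mX : forall t : R, 0 <= t -> measurable_fun setT (X t).

Lemma measurable_cell_select n (c : nat -> T -> R) :
  (forall k, measurable_fun setT (c k)) ->
  measurable_fun setT (fun p : T * R => c (cell n p.2) p.1).
Proof.
move=> mc _ B mB; rewrite setTI.
have -> : (fun p : T * R => c (cell n p.2) p.1) @^-1` B =
    \bigcup_k ((c k @^-1` B) `*` [set s : R | cell n s = k]).
  apply/seteqP; split=> [p Bp|p [k _ [/= h e]]]; first by exists (cell n p.2).
  by rewrite /preimage/= e.
apply: bigcup_measurable => k _; apply: measurableX.
  by rewrite -[X in measurable X]setTI; exact: mc.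
have := measurable_cell_fun n (fun j => (j == k)%:R : R) measurableT (measurable_set1 1).
rewrite setTI; congr measurable; apply/seteqP; split=> s /=.
  by case: eqP => // _ /eqP; rewrite eq_sym oner_eq0.
by move=> ->; rewrite eqxx.
Qed.

Lemma measurable_limit_drift_joint :
  measurable_fun setT (fun p : T * R => limit_drift alpha b (X ^~ p.1) p.2).
Proof.
apply: measurable_fun_limn_sup.
- move=> p _; exists `|p.2| => _ [n _ <-].
  exact: le_trans (ler_norm _) (drift_bound _ _ _ _ _).
- move=> p _; exists (- `|p.2|) => _ [n _ <-].
  by have := drift_bound alpha b (X ^~ p.1) n p.2; rewrite ler_norml => /andP[].
move=> n.
have me k : measurable_fun setT (fun w => euler alpha b (X ^~ w) n k).
  by apply: measurable_euler_rv => j _; apply: mX; exact: dyad_ge0.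
apply: measurable_funD.
  exact: (measurable_cell_select n (c := fun k w => euler alpha b (X ^~ w) n k)).
apply: measurable_funM.
  apply: measurable_funB => //.
  exact: (measurableT_comp (measurable_cell_fun n (dyad R n)) measurable_snd).
apply: (measurable_cell_select n (c := fun k w => rate alpha b (X ^~ w) n k)) => k.
by apply: measurable_rate_rv => //; apply: mX; exact: dyad_ge0.
Qed.

End measurable_scheme.

Lemma in_ysectionE (T1 T2 : Type) (A : set (T1 * T2)) (y : T2) (x : T1) :
  ysection A y x = A (x, y).
Proof. by rewrite /ysection/= inE. Qed.

Lemma in_xsectionE (T1 T2 : Type) (A : set (T1 * T2)) (x : T1) (y : T2) :
  xsection A x y = A (x, y).
Proof. by rewrite /xsection/= inE. Qed.

(** * The level set and the solution *)

Section level_set.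
Variables (d : measure_display) (T : measurableType d) (R : realType).
Variables (P : probability T R) (X : R -> T -> R) (x alpha b : R).
Local Notation mu := (@lebesgue_measure R).
Hypothesis alpha0 : 0 < alpha.
Hypothesis levyX : levy_process P x X.
Variable r0 : R.
Hypothesis r00 : 0 < r0.
Hypothesis small : forall r : R, 0 < r -> r < r0 ->
  (P [set w | (`|X r w - X 0 w| <= alpha * r)%R] <= (3 / 4)%:E)%E.

Let mX : forall t : R, 0 <= t -> measurable_fun setT (X t).
Proof. by case: levyX. Qed.

Definition refracted (t : R) (w : T) : R := X t w - alpha * limit_drift alpha b (X ^~ w) t.

Lemma adapted_refracted : adapted (natural_filtration X) refracted.
Proof.
move=> t t0 B mB.
pose G := \bigcup_(s in `[0, t]%classic) preimage_set_system setT (X s) measurable.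
have mXG (r : R) : 0 <= r <= t -> measurable_fun setT (X r : g_sigma_algebraType G -> R).
  move=> rt _ C mC; apply: sub_sigma_algebra; exists r; first by rewrite /= in_itv.
  by exists C.
have mY : measurable_fun setT (refracted t : g_sigma_algebraType G -> R).
  apply: measurable_funB; first by apply: mXG; rewrite t0 lexx.
  apply: measurable_funM; first exact: measurable_cst.
  exact: (@measurable_limit_drift_rv _ (g_sigma_algebraType G) R X).
by have := mY measurableT B mB; rewrite setTI.
Qed.

(* Off the cadlag paths X is not known to be jointly measurable; its values on
   dyadic grids are. *)
Let gap (p : T * R) : \bar R := limn_esup (fun n =>
  (`|X (dyad R n (cell n p.2).+1) p.1 - alpha * limit_drift alpha b (X ^~ p.1) p.2 - b|)%:E).

Let measurable_gap : measurable_fun setT gap.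
Proof.
apply: measurable_fun_limn_esup => n; apply/measurable_EFinP.
apply: measurableT_comp => //; apply: measurable_funB => //; apply: measurable_funB.
  apply: (measurable_cell_select n (c := fun k w => X (dyad R n k.+1) w)) => k.
  by apply: mX; exact: dyad_ge0.
by apply: measurable_funM => //; exact: measurable_limit_drift_joint.
Qed.

Let gapE (w : T) (s : R) : cadlag (X ^~ w) -> 0 <= s ->
  gap (w, s) = (`|refracted s w - b|)%:E.
Proof.
move=> cw s0; have cv : (`|X (dyad R n (cell n s).+1) w - alpha * limit_drift alpha b (X ^~ w)
  s - b|)%:E
    @[n --> \oo] --> (`|refracted s w - b|)%:E.
  apply: cvg_EFin; first by apply: nearW.
  apply: cvg_norm; apply: cvgB; last exact: cvg_cst.
  apply: cvgB; last exact: cvg_cst.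
  by apply: (@cvg_right_grid _ (X ^~ w)) => //; case: cw => + _; exact.
rewrite /gap is_cvg_limn_esupE; last by apply/cvg_ex; eexists; exact: cv.
exact: (cvg_lim _ cv).
Qed.

(** A jointly measurable substitute for the level set of the solution at [b], equal to it on cadlag
    paths. *)
Definition contact (K : R) : set (T * R) := [set p | 0 <= p.2 <= K /\ gap p = 0%E].

Lemma measurable_contact K : measurable (contact K).
Proof.
have -> : contact K = (setT `*` `[0, K]%classic) `&` (gap @^-1` [set 0%E]).
  by apply/seteqP; split=> p /=; rewrite in_itv/= => -[]; [move=> h1 h2|move=> [_ h1] h2].
apply: measurableI; first exact: measurableX.
by rewrite -[X in measurable X]setTI; apply: measurable_gap => //; exact: emeasurable_set1.
Qed.

Lemma contactE K (w : T) (s : R) : cadlag (X ^~ w) ->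
  contact K (w, s) <-> (0 <= s <= K /\ refracted s w = b).
Proof.
move=> cw; split=> -[sK h]; split => //; have /andP[s0 _] := sK.
  move: h; rewrite (gapE cw s0) => -[] /eqP; rewrite normr_eq0 subr_eq0.
  by move/eqP.
by rewrite (gapE cw s0) h subrr normr0.
Qed.

Lemma le_probability_null (A B N : set T) : measurable A -> measurable B ->
  measurable N -> P N = 0%E -> A `<=` B `|` N -> (P A <= P B)%E.
Proof.
move=> mA mB mN N0 AB; apply: (@le_trans _ _ (P (B `|` N))).
  by apply: le_measure => //; apply/mem_set => //; exact: measurableU.
by rewrite measureU0.
Qed.

Lemma contact_pair_bound K (s u : R) : s < u -> u < s + r0 ->
  (P (ysection (contact K) s `&` ysection (contact K) u) <=
   (3 / 4)%:E * P (ysection (contact K) s))%E.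
Proof.
move=> su us.
have mC t : measurable (ysection (contact K) t)
  by exact: measurable_ysection (measurable_contact K).
have [sK|nsK] := boolP (0 <= s <= K); last first.
  rewrite (_ : ysection _ s = set0) ?set0I ?measure0 ?mule0//.
  by apply/seteqP; split=> w //; rewrite in_ysectionE => -[/= h]; rewrite h in nsK.
have /andP[s0 _] := sK; have u0 : 0 <= u by rewrite (le_trans s0)// ltW.
have [N [mN N0 sN]] := levy_cadlag levyX.
have cad w : ~ N w -> cadlag (X ^~ w) by move=> nN; apply: contrapT => h; apply: nN; exact: sN.
(* The section of [contact] is built from values of [X] after [s], so independence from the past is
   applied to [A] instead, which agrees with it off the null set [N]. *)
pose A := refracted s @^-1` [set b].
pose B := `[(- (alpha * (u - s))), alpha * (u - s)]%classic : set R.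
pose I := (X u \- X s) @^-1` B.
have FA : natural_filtration X s A by exact: adapted_refracted.
have mA : measurable A.
  rewrite -[X in measurable X]setTI.
  have : measurable_fun setT (refracted s).
    apply: measurable_funB; first exact: mX.
    apply: measurable_funM => //; apply: measurable_limit_drift_rv => // r /andP[r0' _].
    exact: mX.
  by apply => //; exact: measurable_set1.
have mI : measurable I.
  rewrite -[X in measurable X]setTI.
  have : measurable_fun setT (X u \- X s) by apply: measurable_funB; exact: mX.
  by apply => //; exact: measurable_itv.
have us0 : 0 < u - s by rewrite subr_gt0.
have PI : (P I <= (3 / 4)%:E)%E.
  have := levy_stationary levyX s0 (ltW us0) (measurable_itv `[(- (alpha * (u - s))), alpha *
    (u - s)]).
  rewrite addrC subrK => ->; apply: le_trans (small us0 _); last by rewrite ltrBlDl.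
  rewrite le_eqVlt; apply/orP; left; apply/eqP; congr (P _).
  by apply/seteqP; split=> w /=; rewrite in_itv/= ler_norml.
apply: (@le_trans _ _ (P (A `&` I))).
  apply: (@le_probability_null _ _ N) => //; [exact: measurableI|exact: measurableI|].
  move=> w [+ +]; rewrite !in_ysectionE => hs hu.
  have [Nw|nNw] := pselect (N w); [by right|left].
  have cw := cad w nNw.
  have [_ rs] := (contactE K s cw).1 hs; have [_ ru] := (contactE K u cw).1 hu.
  split => //; rewrite /I/B/= in_itv/=.
  have := limit_drift_lip b alpha0 cw s0 (ltW su).
  move: rs ru; rewrite /refracted.
  move: (limit_drift _ _ _ s) (limit_drift _ _ _ u) (X s w) (X u w) =>
    a1 a2 x1 x2 e1 e2 /andP[h1 h2].
  have g1 := mulr_ge0 (ltW alpha0) h1; have g2 := ler_wpM2l (ltW alpha0) h2.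
  by apply/andP; split; lra.
rewrite (levy_independent levyX s0 (ltW su) FA)//; last exact: measurable_itv.
rewrite muleC; apply: (@le_trans _ _ ((3 / 4)%:E * P A)%E); first exact: lee_wpmul2r.
apply: lee_wpmul2l; first by rewrite lee_fin.
apply: (@le_probability_null _ _ N) => // w Aw.
have [Nw|nNw] := pselect (N w); [by right|left].
by rewrite in_ysectionE; apply/(contactE K s (cad w nNw)).
Qed.

Lemma contact_null : {ae P, forall w, forall K : nat, mu (xsection (contact K%:R) w) = 0%E}.
Proof.
apply: ae_forall_nat => K; apply: (@density_null _ _ _ P _ K%:R r0 (3 / 4)) => //.
- exact: measurable_contact.
- by move=> p [].
- lra.
- by move=> s u; exact: contact_pair_bound.
Qed.

Lemma refracted_satisfies_sde : satisfies_sde P X alpha b refracted.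
Proof.
apply: ae_imp (ae_and (levy_cadlag levyX) contact_null) => w [cw cn] t t0.
have mr : measurable_fun `[0, t] (fun s => refracted s w).
  apply: measurable_funB; first exact: measurable_cadlag.
  apply: measurable_funM; first exact: measurable_cst.
  exact: measurable_limit_drift.
split; first exact: (measurable_above_comp b mr).
rewrite {1}/refracted (limit_drift_eq alpha0 cw t0)//.
(* Integer horizons keep a single exceptional null set for all [t]. *)
pose K := (Num.truncn t).+1.
exists (xsection (contact K%:R) w); split.
- by apply: measurable_xsection; exact: measurable_contact.
- exact: cn.
move=> s /= /not_implyP[]; rewrite in_itv/= => /andP[s0 st] /negP; rewrite negbK => /eqP sb.
rewrite in_xsectionE; apply/(contactE _ _ cw); split => //.
rewrite s0 (le_trans st)// ltW//; exact: truncnS_gt.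
Qed.

End level_set.

(** * Uniqueness and conclusion *)

Lemma pathwise_uniqueness d (T : measurableType d) (R : realType) (P : probability T R)
    (X : R -> T -> R) (alpha b : R) (Y Y' : R -> T -> R) : 0 < alpha ->
  satisfies_sde P X alpha b Y -> satisfies_sde P X alpha b Y' ->
  {ae P, forall w, forall t : R, 0 <= t -> Y t w = Y' t w}.
Proof.
move=> a0 sY sY'; apply: ae_imp (ae_and sY sY') => w [hY hY'] t t0.
pose p s := above b (Y s w); pose q s := above b (Y' s w).
have [mp _] := hY t t0; have [mq _] := hY' t t0.
have eY s : 0 <= s -> Y s w = X s w - alpha * primitive p s by move=> s0; have [_] := hY s s0.
have eY' s : 0 <= s -> Y' s w = X s w - alpha * primitive q s by move=> s0; have [_] := hY' s s0.
(* Two exact solutions involve no grid, so the error function in [sqr_primitive_sub_le] is 0. *)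
suff : (primitive p t - primitive q t) ^+ 2 <= 2 * primitive (cst 0) t.
  rewrite {3}/primitive Rintegral_cst// mul0r mulr0 => h.
  have : (primitive p t - primitive q t) ^+ 2 == 0 by rewrite eq_le h sqr_ge0.
  by rewrite sqrf_eq0 subr_eq0 eY// eY'// => /eqP ->.
apply: (@sqr_primitive_sub_le _ t 0) => //.
- by move=> s _; exact: above01.
- by move=> s _; exact: above01.
- by move=> s _; rewrite normr0.
move=> s /andP[s0 _] /=.
have [h|h] := leP (primitive q s) (primitive p s).
  have : Y s w <= Y' s w by rewrite eY// eY'// lerD2l lerN2 ler_pM2l.
  by move=> /(above_monotone b); rewrite -/(p s) -/(q s) => h'; nra.
have : Y' s w <= Y s w by rewrite eY// eY'// lerD2l lerN2 ler_pM2l// ltW.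
by move=> /(above_monotone b); rewrite -/(p s) -/(q s) => h'; nra.
Qed.

Lemma small_increment_prob d (T : measurableType d) (R : realType) (P : probability T R)
    (X : R -> T -> R) (x gamma sigma : R) (Pi : {measure set R -> \bar R}) (alpha : R) :
  levy_process P x X -> levy_triplet P X gamma sigma Pi ->
  unbounded_variation_paths P X ->
  (Pi `]-oo, 0%R[%classic < +oo)%E \/ (Pi `]0%R, +oo[%classic < +oo)%E ->
  0 < alpha ->
  exists2 r0 : R, 0 < r0 & forall r : R, 0 < r -> r < r0 ->
    (P [set w | (`|X r w - X 0 w| <= alpha * r)%R] <= (3 / 4)%:E)%E.
Proof.
move=> lX tr uv os a0; have mX := levy_measurable lX.
have [s0 _ _] := tr; move: s0; rewrite le_eqVlt => /predU1P[sE|s0]; last first.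
  exact: (small_increment_gauss mX tr).
have [fin|] := ltP (\int[Pi]_z (Num.min 1 `|z|)%:E)%E +oo%E.
  by exfalso; move: tr; rewrite -sE => tr; exact: (not_unbounded_variation_paths lX tr fin).
rewrite leye_eq => /eqP infv.
(* The sign [eps] is chosen so that [eps * z < 0] describes the half-line of finite mass. *)
case: os => os.
- apply: (@small_increment_jumps _ _ _ _ _ _ _ _ mX tr alpha 1) => //; first by left.
  rewrite (_ : [set _ | _] = `]-oo, 0%R[%classic)//.
  by apply/seteqP; split=> z /=; rewrite in_itv/= mul1r.
- apply: (@small_increment_jumps _ _ _ _ _ _ _ _ mX tr alpha (-1)) => //; first by right.
  rewrite (_ : [set _ | _] = `]0%R, +oo[%classic)//.
  by apply/seteqP; split=> z /=; rewrite in_itv/= andbT mulN1r oppr_lt0.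
Qed.

Theorem corollary2p4 (d : measure_display) (T : measurableType d)
    (R : realType) (P : probability T R) (X : R -> T -> R) (x : R)
    (gamma sigma : R) (Pi : {measure set R -> \bar R}) (alpha b : R) :
  levy_process P x X ->
  levy_triplet P X gamma sigma Pi ->
  unbounded_variation_paths P X ->
  (Pi `]-oo, 0%R[%classic < +oo)%E \/ (Pi `]0%R, +oo[%classic < +oo)%E ->
  0 < alpha ->
  has_unique_strong_solution P X alpha b.
Proof.
move=> lX tr uv os a0.
have [r0 r00 small] := small_increment_prob lX tr uv os a0.
split; last by move=> Y Y' [_ sY] [_ sY']; exact: (pathwise_uniqueness a0 sY sY').
exists (refracted X alpha b); split; first exact: adapted_refracted.
exact: (refracted_satisfies_sde b a0 lX r00 small).
Qed.
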